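(* Let $\gamma>0$, $m\in(-1,1)$, and let $u=u(z)$ be an axisymmetric pattern on $\mathbb{S}^2$ with $n\ge1$ interfaces $-1<z_1<\dots<z_n<1$ and mass $m$, which is a critical point of $E_\gamma$ with respect to one-dimensional perturbations in the $z$-variable. Then $u$, as a function on $\mathbb{S}^2$, is a critical point of $E_\gamma$ with respect to all perturbations in the sense that it solves the Euler--Lagrange equation: there is a constant $\lambda\in\mathbb{R}$ such that $$\kappa_g(z_k)+4\gamma\,v(z_k)=\lambda\qquad\text{for all }k=1,\dots,n.$$
   Context: For $u\in BV(\mathbb{S}^2;\{\pm1\})$ with $\frac1{4\pi}\int_{\mathbb{S}^2}u\,d\mathcal{H}^2=m$ and $\gamma>0$, the energy is $$E_\gamma(u)=\frac12\int_{\mathbb{S}^2}|\nabla u|+\gamma\int_{\mathbb{S}^2}|\nabla v|^2\,d\mathcal{H}^2,$$ where $\int_{\mathbb{S}^2}|\nabla u|$ is the total variation of $u$, $v$ solves $-\Delta v=u-m$ on $\mathbb{S}^2$ ($\Delta$ is the Laplace--Beltrami operator of the unit sphere, and $v$ is unique up to an additive constant) and $\nabla$ is the gradient on $\mathbb{S}^2$. Functions on $\mathbb{S}^2$ depending only on the polar angle $\phi$ are regarded as functions of $z=\cos\phi\in[-1,1]$. An axisymmetric pattern with $n$ interfaces at $-1=z_0<z_1<\dots<z_n<z_{n+1}=1$ is the function $u$ with $u=(-1)^{k+1}$ on $[z_k,z_{k+1})$ for $k=0,\dots,n$; its mass is $\frac1{4\pi}\int_{\mathbb{S}^2}u\,d\mathcal{H}^2=\frac12\sum_{k=1}^{n+1}(-1)^k(z_k-z_{k-1})$.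 For such $u$, $v$ is also a function of $z$. Let $A=\{u=1\}$. The number $\kappa_g(z_k)$ is the (constant) signed geodesic curvature of the component $\{z=z_k\}$ of $\partial A$ with respect to the normal pointing out of $A$, positive for the boundary of a cap $A$ smaller than a hemisphere; explicitly $\kappa_g(z_k)=(-1)^{k+1}z_k/\sqrt{1-z_k^2}$. The pattern $u$ is a critical point with respect to one-dimensional perturbations in the $z$-variable if, for every smooth family $t\mapsto(z_1(t),\dots,z_n(t))$ of interface locations with $z_k(0)=z_k$ whose associated patterns $u_t$ all have mass $m$, one has $\frac{d}{dt}\big|_{t=0}E_\gamma(u_t)=0$. *)

(* Defs.v *)
From mathcomp Require Import all_boot all_order all_algebra.
From mathcomp Require Import all_classical all_reals all_analysis.

Set Implicit Arguments.
Unset Strict Implicit.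
Unset Printing Implicit Defensive.

Import Order.TTheory GRing.Theory Num.Theory.
Import numFieldNormedType.Exports.

Local Open Scope classical_set_scope.
Local Open Scope ring_scope.

(** * Calculus on the unit sphere of R^3 *)

(* The library norm on 'rV[R]_3 is the sup norm, so the Euclidean structure
   goes through [dot]. *)
Definition dot (R : realType) (x y : 'rV[R]_3) : R :=
  \sum_(i < 3) x 0 i * y 0 i.

Definition sphere (R : realType) : set 'rV[R]_3 := [set x | dot x x = 1].

Definition height (R : realType) (x : 'rV[R]_3) : R := x 0 ord_max.

Definition sphere_point (R : realType) (z theta : R) : 'rV[R]_3 :=
  \row_(i < 3) [:: Num.sqrt (1 - z ^+ 2) * cos theta;
                   Num.sqrt (1 - z ^+ 2) * sin theta;
                   z]`_i.

(* Surface integral in the coordinates (z, theta), whose area element is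
   dH^2 = dtheta dz (from sin phi dphi dtheta with z = cos phi). *)
Definition sphere_int (R : realType) (f : 'rV[R]_3 -> R) : R :=
  \int[lebesgue_measure]_(z in `[(-1 : R), 1])
    \int[lebesgue_measure]_(theta in `[(0 : R), 2 * pi])
      f (sphere_point z theta).

(* C^1 functions on the sphere are represented by C^1 functions on R^3.  The
   operators below only depend, at points of the sphere, on the restriction of
   their argument to the sphere. *)
Definition C1 (R : realType) (f : 'rV[R]_3 -> R) : Prop :=
  (forall x, differentiable f x) /\
  (forall i : 'I_3, continuous (fun x => 'D_(delta_mx 0 i) f x)).

Definition grad (R : realType) (f : 'rV[R]_3 -> R) (x : 'rV[R]_3) : 'rV[R]_3 :=
  \row_(i < 3) 'D_(delta_mx 0 i) f x.

Definition sphere_grad (R : realType) (f : 'rV[R]_3 -> R) (x : 'rV[R]_3) :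
    'rV[R]_3 :=
  grad f x - dot (grad f x) x *: x.

(* Trace of DX(x) over the tangent plane: tr DX(x) - <DX(x) x, x>, which is the
   intrinsic divergence when X is tangent to the sphere. *)
Definition sphere_div (R : realType) (X : 'rV[R]_3 -> 'rV[R]_3)
    (x : 'rV[R]_3) : R :=
  \sum_(i < 3) sphere_grad (fun y => X y 0 i) x 0 i.

Definition tangent_field (R : realType) (X : 'rV[R]_3 -> 'rV[R]_3) : Prop :=
  (forall i : 'I_3, C1 (fun x => X x 0 i)) /\
  (forall x, sphere x -> dot (X x) x = 0).

Definition total_variation (R : realType) (u : 'rV[R]_3 -> R) : \bar R :=
  ereal_sup [set (sphere_int (fun x => u x * sphere_div X x))%:E | X in
    [set X | tangent_field X /\ forall x, sphere x -> dot (X x) (X x) <= 1]].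

(** * The energy *)

Definition mass (R : realType) (u : 'rV[R]_3 -> R) : R :=
  (4 * pi)^-1 * sphere_int u.

(* - Delta v = u - m, in weak form since u jumps.  For bounded u every weak
   solution is C^1 by elliptic regularity. *)
Definition poisson (R : realType) (m : R) (u v : 'rV[R]_3 -> R) : Prop :=
  C1 v /\
  forall eta, C1 eta ->
    sphere_int (fun x => dot (sphere_grad v x) (sphere_grad eta x)) =
    sphere_int (fun x => (u x - m) * eta x).

(* The value does not depend on the chosen v: two solutions differ by a
   constant on the sphere. *)
Definition nonlocal_energy (R : realType) (m : R) (u : 'rV[R]_3 -> R) : R :=
  let v := xget (cst 0) [set v | poisson m u v] in
  sphere_int (fun x => dot (sphere_grad v x) (sphere_grad v x)).

Definition energy (R : realType) (gamma m : R) (u : 'rV[R]_3 -> R) : \bar R :=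
  ((2^-1)%:E * total_variation u + (gamma * nonlocal_energy m u)%:E)%E.

(** * Axisymmetric patterns *)

(* The tuple z lists z_1, ..., z_n; thus z_k is [tnth z i] with i = k - 1. *)
Definition interfaces (R : realType) (n : nat) (z : n.-tuple R) : Prop :=
  path <%R (-1) (rcons z 1).

(* The number of interfaces at or below height s is the k such that s lies in
   [z_k, z_(k+1)) (k = n at the north pole). *)
Definition pattern (R : realType) (n : nat) (z : n.-tuple R)
    (x : 'rV[R]_3) : R :=
  (-1) ^+ (count (fun y => y <= height x) z).+1.

(* (-1)^(k+1) z_k / sqrt (1 - z_k^2) with k = i + 1. *)
Definition geodesic_curvature (R : realType) (n : nat) (z : n.-tuple R)
    (i : 'I_n) : R :=
  (-1) ^+ i.+2 * (tnth z i / Num.sqrt (1 - tnth z i ^+ 2)).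

Definition admissible_family (R : realType) (m : R) (n : nat)
    (z : n.-tuple R) (Z : R -> n.-tuple R) : Prop :=
  Z 0 = z /\
  exists2 e : R, 0 < e & forall t, `|t| < e ->
    [/\ interfaces (Z t),
        mass (pattern (Z t)) = m &
        forall (i : 'I_n) (j : nat),
          derivable (derive1n j (fun s => tnth (Z s) i)) t 1].

Definition critical_1d (R : realType) (gamma m : R) (n : nat)
    (z : n.-tuple R) : Prop :=
  forall Z : R -> n.-tuple R, admissible_family m z Z ->
    is_derive (0 : R) (1 : R)
      (fun t : R => fine (energy gamma m (pattern (Z t)))) 0.

(* Main.v *)
From mathcomp Require Import all_boot all_order all_algebra.
From mathcomp Require Import all_classical all_reals all_analysis.
From mathcomp Require Import ring lra.
Require Import Defs.

(** Axial symmetry reduces both terms of the energy to the heights of the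
    interfaces.  With the interfaces numbered from 0, half of the total variation
    of the pattern is [2 * pi * sum of sqrt (1 - z_i^2)]
    ([total_variation_pattern]), whose derivative with respect to [z_i] is
    [- 2 pi (-1)^i kappa_g(z_i)].  The derivative of the nonlocal term is
    [- 8 pi (-1)^i v(z_i)], because moving an interface changes the charge [u]
    only there.  A variation [d] of the heights keeps the mass exactly when
    [sum of (-1)^i d_i = 0].  So criticality says that the linear form in [d]
    with coefficients [(-1)^i (kappa_g(z_i) + 4 gamma v(z_i))] vanishes on the
    hyperplane orthogonal to [(-1)^i]; taking [d] supported on two interfaces
    shows that all the brackets agree.

    The total variation is a supremum over tangent fields.  Integrating the
    divergence over a band of latitudes leaves the flux of the third component
    through its two boundary circles ([integral_zonal_div]), so a pattern
    is tested only through the fluxes at the [z_i], each at most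
    [2 * pi * sqrt (1 - z_i^2)].  Equality needs a field that has unit length on
    every interface and alternates in direction; [optimal_field] is an explicit
    one.

    The nonlocal term is defined through an arbitrary solution of the Poisson
    equation, so a solution must exist: the potentials of single steps in the
    height are explicit, and they superpose ([poisson_height]).  Testing two
    solutions against each other shows that the energy does not depend on the
    choice ([nonlocal_energyE]).  The potential of the moving pattern is never
    differentiated.  Positivity of the Dirichlet form gives, for the fixed [v],
    [2 int (u_t - m) v - int |grad v|^2] as a lower bound of the nonlocal energy
    of [u_t], with equality at [t = 0] ([nonlocal_energy_ge]).  This bound is
    explicit in the heights, hence differentiable ([is_derive_energy_minorant]),
    and the energy minus the bound has a minimum at [t = 0], so the two have the
    same derivative there ([first_variation]).

    The first variation sees only the average of [v] over each interface.
    The given [v] has the same gradient as the height-dependent solution, since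
    their difference has zero Dirichlet energy; hence it is constant along
    parallels ([poisson_axisymmetric]) and equals its average. *)

Set Implicit Arguments.
Unset Strict Implicit.
Unset Printing Implicit Defensive.

Import Order.TTheory GRing.Theory Num.Theory.
Import numFieldNormedType.Exports.

Local Open Scope classical_set_scope.
Local Open Scope ring_scope.

(** * One-variable calculus *)

Section OneVariable.
Variable R : realType.
Implicit Types (f g F : R -> R) (a b x : R).
Local Notation mu := (@lebesgue_measure R).

Lemma within_continuous_integrable f a b :
  {within `[a, b], continuous f} -> mu.-integrable `[a, b] (EFin \o f).
Proof.
by move=> cf; apply: continuous_compact_integrable => //; exact: segment_compact.
Qed.

Lemma continuous_integrable f a b :
  continuous f -> mu.-integrable `[a, b] (EFin \o f).
Proof.
by move=> cf; apply: within_continuous_integrable; exact: continuous_subspaceT.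
Qed.

Lemma Rintegral_cat f a b c : continuous f -> a <= b -> b <= c ->
  \int[mu]_(x in `[a, c]) f x =
  (\int[mu]_(x in `[a, b]) f x) + \int[mu]_(x in `[b, c]) f x.
Proof.
move=> cf ab bc.
have := @Rintegral_itvB R f (BLeft a) (BRight c) b (continuous_integrable a c cf).
rewrite !bnd_simp => /(_ ab bc); rewrite Rintegral_itv_obnd_cbnd; last first.
  apply: (integrableS _ _ _ (continuous_integrable b c cf)) => //.
  by apply: subset_itvr; rewrite bnd_simp.
by move=> <-; rewrite addrC subrK.
Qed.

Lemma is_derive_continuous f F : (forall x, is_derive x 1 F (f x)) -> continuous F.
Proof.
move=> dF y; apply/differentiable_continuous/derivable1_diffP.
by have [] := dF y.
Qed.

(** The primitive is the signed integral from 0.  Near [x] it differs by a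
    constant from the integral based at some [b < x], to which the fundamental
    theorem applies. *)
Lemma continuous_primitive f : continuous f ->
  exists F, forall x, is_derive x 1 F (f x).
Proof.
move=> cf.
pose J a b := \int[mu]_(t in `[a, b]) f t.
pose F x := J 0 x - J x 0.
exists F => x.
(* Any base point to the left of both 0 and x. *)
pose b : R := Num.min x 0 - 1.
have Jadd p q r : p <= q -> q <= r -> J p r = J p q + J q r by exact: Rintegral_cat.
have b0 : b <= 0 by rewrite /b; case: (leP x 0); lra.
have bx : b < x by rewrite /b; case: (leP x 0); lra.
have J00 : J 0 0 = 0 by rewrite /J set_itv1 Rintegral_set1.
have FE y : b <= y -> F y = J b y - J b 0.
  move=> yb; rewrite /F; case: (leP 0 y) => y0.
    rewrite (Jadd b 0 y) //.
    case: (eqVneq y 0) => [->|yn]; first by rewrite J00; lra.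
    rewrite [J y 0](_ : _ = 0); first lra.
    rewrite /J set_itv_ge ?Rintegral_set0// bnd_simp -ltNge.
    by rewrite lt_neqAle eq_sym yn.
  rewrite (Jadd b y 0) ?(ltW y0) // [J 0 y](_ : _ = 0); first lra.
  by rewrite /J set_itv_ge ?Rintegral_set0// bnd_simp -ltNge.
have xx1 : x < x + 1 by lra.
have [dJ J'] := @continuous_FTC1_closed R f b x (x + 1) xx1 (@continuous_integrable f _ _ cf) bx (cf x).
have dJx : is_derive x 1 (fun y => J b y - J b 0) (f x).
  have -> : (fun y => J b y - J b 0) = J b - cst (J b 0) by [].
  have dJb : is_derive x 1 (J b) (f x).
    by apply: DeriveDef; [exact: dJ|rewrite -derive1E; exact: J'].
  by apply: is_derive_eq; rewrite subr0.
apply: (near_eq_is_derive _ dJx).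
near=> y; apply/esym/FE.
suff : y \in `]b, x + 1[ by rewrite in_itv /= => /andP[/ltW].
by near: y; apply: near_in_itvoo; rewrite in_itv /= bx xx1.
Unshelve. all: by end_near. Qed.

(** Differentiability is asked only in the open interval: integrals over
    latitudes are continuous, but not always differentiable, at the poles. *)
Lemma Rintegral_is_derive f F a b : a <= b ->
  {within `[a, b], continuous f} -> {within `[a, b], continuous F} ->
  {in `]a, b[, forall x, is_derive x 1 F (f x)} ->
  \int[mu]_(x in `[a, b]) f x = F b - F a.
Proof.
rewrite le_eqVlt => /predU1P[->|ab] cf cF dF.
  by rewrite set_itv1 Rintegral_set1 subrr.
rewrite /Rintegral.
have := @continuous_FTC2 R f F a b ab cf.
move/(continuous_within_itvP _ ab) : cF => [cF Fa Fb].
move=> /(_ _ _)-> //.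
- split => //.
  by move=> x /dF [].
- move=> x /dF dFx; rewrite derive1E; exact: derive_val.
Qed.

Definition heaviside a x : R := (a <= x)%R%:R.

Lemma Rintegral_step f a : -1 <= a <= 1 -> continuous f ->
  \int[mu]_(x in `[(-1)%R, 1%R]) (heaviside a x * f x) = \int[mu]_(x in `[a, 1]) f x.
Proof.
move=> /andP[a0 a1] cf.
rewrite Rintegral_mkcond [RHS]Rintegral_mkcond.
apply: eq_Rintegral => x _; rewrite /heaviside /patch !mem_setE !in_itv /=.
case: (leP a x) => ax /=.
  by rewrite (le_trans a0 ax) /= mul1r.
by rewrite mul0r; case: ifP.
Qed.

Lemma step_integrable f a b c : continuous f ->
  mu.-integrable `[a, b] (EFin \o (fun x => heaviside c x * f x)).
Proof.
move=> cf.
have -> : (fun x => heaviside c x * f x) = f \_ `[c, +oo[.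
  apply/funext => x; rewrite /heaviside /patch mem_setE in_itv /= andbT.
  by case: ifP; rewrite ?mul1r ?mul0r.
rewrite -restrict_EFin; apply/integrable_restrict => //.
apply: integrableS (continuous_integrable a b cf) => //; try exact: measurableI.
Qed.

(** A primitive is nondecreasing with equal end values, hence constant. *)
Lemma continuous_Rintegral_eq0 f a b : continuous f ->
  (forall x, x \in `[a, b] -> 0 <= f x) ->
  \int[mu]_(x in `[a, b]) f x = 0 -> {in `]a, b[, forall x, f x = 0}.
Proof.
move=> cf f0 I0.
have [F dF] := continuous_primitive cf.
move=> x xab.
have [ax xb] : a < x /\ x < b by move: xab; rewrite in_itv /= => /andP[].
have ab := lt_trans ax xb.
have cF := is_derive_continuous dF.
have IE (c d : R) : c <= d -> \int[mu]_(t in `[c, d]) f t = F d - F c.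
  move=> cd; apply: Rintegral_is_derive => //; first exact: continuous_subspaceT.
  exact: continuous_subspaceT.
have mono c d : a <= c -> c <= d -> d <= b -> F c <= F d.
  move=> ac cd db; rewrite -subr_ge0 -IE //; apply: Rintegral_ge0 => t /=.
  rewrite in_itv /= => /andP[ct td]; apply: f0.
  by rewrite in_itv /= (le_trans ac ct) (le_trans td db).
move: I0; rewrite IE ?(ltW ab) // => Fab.
have Fc y : y \in `]a, b[ -> F y = F a.
  rewrite in_itv /= => /andP[/ltW ay /ltW yb].
  have := mono a y (lexx _) ay yb; have := mono y b ay yb (lexx _); lra.
have : is_derive x 1 F 0.
  have dcst := is_derive_cst (F a) x (1 : R).
  apply: (near_eq_is_derive _ dcst).
  near=> y; rewrite /cst; apply/esym/Fc; near: y; exact: near_in_itvoo.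
by move=> /@derive_val <-; rewrite (@derive_val _ _ _ _ _ _ _ (dF x)).
Unshelve. all: by end_near. Qed.

(** Differentiability at the minimum alone suffices; criticality gives no
    information on the energy at other parameters. *)
Lemma is_derive_local_min (f : R -> R) (l e : R) : 0 < e ->
  is_derive (0 : R) 1 f l -> (forall t, `|t| < e -> f 0 <= f t) -> l = 0.
Proof.
move=> e0 [df <-] fmin.
have h0 : 0 <= 'D_1 f 0.
  rewrite ['D_1 f 0]cvg_at_rightE //.
  apply: limr_ge.
    rewrite -(cvg_at_rightE (fun h : R => h^-1 *: ((f \o shift 0) _ - f 0))) //.
    apply: cvg_trans df; apply: cvg_app.
    by move=> A [d dgt0 Ad]; exists d => // x xd xgt0; apply: Ad => //; exact/lt0r_neq0.
  near=> h; apply: mulr_ge0.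
    by rewrite invr_ge0; apply: ltW; near: h; exists 1 => /=.
  rewrite subr_ge0 [_%:A]mulr1 /= addr0; apply: fmin; near: h.
  by exists e => // h /=; rewrite sub0r normrN.
have h1 : 'D_1 f 0 <= 0.
  rewrite ['D_1 f 0]cvg_at_leftE //.
  apply: limr_le.
    rewrite -(cvg_at_leftE (fun h : R => h^-1 *: ((f \o shift 0) _ - f 0))) //.
    apply: cvg_trans df; apply: cvg_app.
    by move=> A [d dgt0 Ad]; exists d => // x xd xgt0; apply: Ad => //; exact/ltr0_neq0.
  near=> h; apply: mulr_le0_ge0.
    by rewrite invr_le0; apply: ltW; near: h; exists 1 => /=.
  rewrite subr_ge0 [_%:A]mulr1 /= addr0; apply: fmin; near: h.
  by exists e => // h /=; rewrite sub0r normrN.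
by apply/eqP; rewrite eq_le h0 h1.
Unshelve. all: by end_near. Qed.

End OneVariable.

(** * Continuously differentiable functions on space *)

Section Space.
Variable R : realType.
Implicit Types (f g : 'rV[R]_3 -> R) (x v : 'rV[R]_3).

Lemma rV_continuous (T : topologicalType) n (c : T -> 'rV[R]_n) t :
  (forall i, continuous_at t (fun s => c s 0 i)) -> continuous_at t c.
Proof.
move=> cc; apply/cvgrPdist_lt => /= e e0.
near=> s.
rewrite /Num.Def.normr/= mx_normrE; apply/bigmax_ltP; split => // -[i j] _ /=.
rewrite !mxE (ord1 i); move: j; near: s; apply: filter_forall => j.
exact: ((cvgrPdist_lt _ _).1 (cc j)).
Unshelve. all: by end_near. Qed.

Lemma is_derive_congr (V W : normedModType R) (h : V -> W) (p d : V) (l l' : W) :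
  is_derive p d h l -> l = l' -> is_derive p d h l'.
Proof. by move=> ? <-. Qed.

Lemma is_derive_mull (h : R -> R) (c t l : R) :
  is_derive t 1 h l -> is_derive t 1 (fun s => c * h s) (c * l).
Proof. by move=> dh; exact: (@is_deriveZ R R R h c t 1 l dh). Qed.

Lemma is_derive_mulr (h : R -> R) (c t l : R) :
  is_derive t 1 h l -> is_derive t 1 (fun s => h s * c) (l * c).
Proof.
move=> /(is_derive_mull c); rewrite mulrC.
by have -> : (fun s => c * h s) = (fun s => h s * c) by apply/funext => s; rewrite mulrC.
Qed.

Lemma is_derive_sum_fun n (h : 'I_n -> R -> R) (t : R) (l : 'I_n -> R) :
  (forall i, is_derive t 1 (h i) (l i)) ->
  is_derive t 1 (fun s => \sum_(i < n) h i s) (\sum_(i < n) l i).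
Proof.
move=> dh; have -> : (fun s => \sum_(i < n) h i s) = \sum_(i < n) h i.
  by apply/funext => s; rewrite fct_sumE.
exact: is_derive_sum.
Qed.

Section PointwiseContinuity.
Variables (T : topologicalType) (t : T).
Implicit Types h k : T -> R.

Lemma continuous_atD h k : continuous_at t h -> continuous_at t k ->
  continuous_at t (fun y => h y + k y).
Proof. by move=> ch ck; exact: (@cvgD R R^o T). Qed.

Lemma continuous_atB h k : continuous_at t h -> continuous_at t k ->
  continuous_at t (fun y => h y - k y).
Proof. by move=> ch ck; exact: (@cvgB R R^o T). Qed.

Lemma continuous_atM h k : continuous_at t h -> continuous_at t k ->
  continuous_at t (fun y => h y * k y).
Proof. by move=> ch ck; exact: (@cvgM R T). Qed.

Lemma continuous_atV h : h t != 0 -> continuous_at t h ->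
  continuous_at t (fun y => (h y)^-1).
Proof. by move=> h0 ch; exact: (@cvgV R T). Qed.

Lemma continuous_at_norm h : continuous_at t h ->
  continuous_at t (fun y => `|h y|).
Proof. by move=> ch; exact: (@cvg_norm R R^o T). Qed.

Lemma continuous_at_sum n (F : 'I_n -> T -> R) :
  (forall i, continuous_at t (F i)) ->
  continuous_at t (fun y => \sum_(i < n) F i y).
Proof.
elim: n F => [|n IH] F cF.
  have -> : (fun y => \sum_(i < 0) F i y) = cst 0.
    by apply/funext => y; rewrite big_ord0.
  exact: cst_continuous.
have -> : (fun y => \sum_(i < n.+1) F i y) =
    (fun y => F ord0 y + \sum_(i < n) F (lift ord0 i) y).
  by apply/funext => y; rewrite big_ord_recl.
by apply: continuous_atD => //; exact: IH.
Qed.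

End PointwiseContinuity.

Lemma is_derive_curve f (c : R -> 'rV[R]_3) (d : 'rV[R]_3) t :
  differentiable f (c t) ->
  (forall i, is_derive t 1 (fun s => c s 0 i) (d 0 i)) ->
  is_derive t 1 (fun s => f (c s)) (dot d (grad f (c t))).
Proof.
move=> df dc.
have cd : derivable c t 1.
  by apply/derivable_mxP => i j; rewrite (ord1 i); have [] := dc j.
have diffc : differentiable c t by exact/derivable1_diffP.
have cE : 'd c t 1 = d.
  rewrite -deriveE // derive_mx //; apply/rowP => i; rewrite mxE.
  exact: (@derive_val _ _ _ _ _ _ _ (dc i)).
have dfc : differentiable (f \o c) t by exact: differentiable_comp.
apply: DeriveDef; first exact: diff_derivable.
rewrite [LHS]deriveE // diff_comp //= cE.
rewrite [d in LHS]row_sum_delta linear_sum /dot; apply: eq_bigr => i _.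
by rewrite linearZ mxE deriveE.
Qed.

Lemma is_derive_comp1 (g : R -> R) f x v (l : R) :
  differentiable f x -> is_derive (f x) 1 g l ->
  is_derive x v (fun y => g (f y)) (l * 'D_v f x).
Proof.
move=> df [dg <-].
have dg' : differentiable g (f x) by exact/derivable1_diffP.
have dgf : differentiable (g \o f) x by exact: differentiable_comp.
apply: DeriveDef; first exact: diff_derivable.
rewrite [LHS]deriveE // diff_comp //= !deriveE //.
by rewrite -[X in 'd g _ X]mulr1 [LHS]linearZ mulrC.
Qed.

Lemma C1_continuous f : C1 f -> continuous f.
Proof. by move=> [df _] x; exact: differentiable_continuous. Qed.

Lemma C1_cst (a : R) : C1 (fun _ : 'rV[R]_3 => a).
Proof.
split=> [x|i]; first exact: differentiable_cst.
have -> : (fun x => 'D_(delta_mx 0 i) (fun _ : 'rV[R]_3 => a) x) = cst 0.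
  by apply/funext => x; rewrite derive_cst.
exact: cst_continuous.
Qed.

Lemma derive_coord x v (i : 'I_3) : 'D_v (fun y : 'rV[R]_3 => y 0 i) x = v 0 i.
Proof.
have := derive_mx (@derivable_id R 'rV[R]_3 x v).
by rewrite derive_id => /(congr1 (fun M : 'rV[R]_3 => M 0 i)) ->; rewrite mxE.
Qed.

Lemma C1_coord (i : 'I_3) : C1 (fun x : 'rV[R]_3 => x 0 i).
Proof.
split=> [x|j]; first exact: differentiable_coord.
under eq_fun do rewrite derive_coord.
exact: cst_continuous.
Qed.

Lemma C1_add f g : C1 f -> C1 g -> C1 (fun x => f x + g x).
Proof.
move=> [df cf] [dg cg]; split=> [x|i]; first exact: differentiableD.
have -> : (fun x => 'D_(delta_mx 0 i) (fun x => f x + g x) x) =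
    (fun x => 'D_(delta_mx 0 i) f x + 'D_(delta_mx 0 i) g x).
  by apply/funext => x; rewrite deriveD //; exact: diff_derivable.
by move=> x; apply: continuous_atD; [exact: cf|exact: cg].
Qed.

Lemma C1_mul f g : C1 f -> C1 g -> C1 (fun x => f x * g x).
Proof.
move=> Cf Cg; have [df cf] := Cf; have [dg cg] := Cg.
split=> [x|i]; first exact: differentiableM.
have -> : (fun x => 'D_(delta_mx 0 i) (fun x => f x * g x) x) =
    (fun x => f x * 'D_(delta_mx 0 i) g x + g x * 'D_(delta_mx 0 i) f x).
  by apply/funext => x; rewrite deriveM //; exact: diff_derivable.
move=> x; apply: continuous_atD; apply: continuous_atM; first exact: C1_continuous.
- exact: cg.
- exact: C1_continuous.
- exact: cf.
Qed.

Lemma C1_opp f : C1 f -> C1 (fun x => - f x).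
Proof.
move=> Cf; have -> : (fun x => - f x) = (fun x => -1 * f x).
  by apply/funext => x; rewrite mulN1r.
by apply: C1_mul => //; exact: C1_cst.
Qed.

Lemma C1_sub f g : C1 f -> C1 g -> C1 (fun x => f x - g x).
Proof. by move=> Cf Cg; apply: C1_add => //; exact: C1_opp. Qed.

Lemma C1_sum n (F : 'I_n -> 'rV[R]_3 -> R) : (forall i, C1 (F i)) ->
  C1 (fun x => \sum_(i < n) F i x).
Proof.
elim: n F => [|n IH] F CF.
  by under eq_fun do rewrite big_ord0; exact: C1_cst.
under eq_fun do rewrite big_ord_recl.
by apply: C1_add => //; apply: IH => i; exact: CF.
Qed.

Lemma C1_prod n (P : pred 'I_n) (F : 'I_n -> 'rV[R]_3 -> R) : (forall i, C1 (F i)) ->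
  C1 (fun x => \prod_(i < n | P i) F i x).
Proof.
move=> CF; under eq_fun do rewrite big_mkcond.
have {}CF i : C1 (fun x => if P i then F i x else 1).
  by case: (P i); [exact: CF|exact: C1_cst].
elim: n P F CF => [|n IH] P F CF.
  by under eq_fun do rewrite big_ord0; exact: C1_cst.
under eq_fun do rewrite big_ord_recl.
apply: C1_mul; first exact: CF.
by apply: (IH (fun i => P (lift ord0 i)) (fun i => F (lift ord0 i))) => i; exact: CF.
Qed.

Lemma C1_comp (h h' : R -> R) f : C1 f ->
  (forall x, is_derive (f x) 1 h (h' (f x))) ->
  (forall x, continuous_at (f x) h') -> C1 (fun x => h (f x)).
Proof.
move=> Cf dh ch'; have [df cf] := Cf; split=> [x|i].
  apply: (@differentiable_comp _ _ _ _ f h) => //.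
  by apply/derivable1_diffP; have [] := dh x.
have -> : (fun x => 'D_(delta_mx 0 i) (fun x => h (f x)) x) =
    (fun x => h' (f x) * 'D_(delta_mx 0 i) f x).
  apply/funext => x.
  exact: (@derive_val _ _ _ _ _ _ _ (is_derive_comp1 (delta_mx 0 i) (df x) (dh x))).
move=> x; apply: continuous_atM; last exact: cf.
by apply: @continuous_comp; [exact: C1_continuous|exact: ch'].
Qed.

Lemma continuous_sum n (F : 'I_n -> 'rV[R]_3 -> R) :
  (forall i, continuous (F i)) -> continuous (fun x => \sum_(i < n) F i x).
Proof.
by move=> cF x; apply: continuous_at_sum => i; exact: cF.
Qed.

Lemma continuous_dot (X Y : 'rV[R]_3 -> 'rV[R]_3) :
  (forall i, continuous (fun x => X x 0 i)) ->
  (forall i, continuous (fun x => Y x 0 i)) ->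
  continuous (fun x => dot (X x) (Y x)).
Proof.
by move=> cX cY; apply: continuous_sum => i x; apply: continuous_atM; [exact: cX|exact: cY].
Qed.

Lemma continuous_grad f i : C1 f -> continuous (fun x => grad f x 0 i).
Proof.
by move=> [_ cf]; under eq_fun do rewrite mxE; exact: cf.
Qed.

Lemma continuous_coord i : continuous (fun x : 'rV[R]_3 => x 0 i).
Proof. exact: C1_continuous (C1_coord i). Qed.

Lemma continuous_sphere_grad f i : C1 f ->
  continuous (fun x => sphere_grad f x 0 i).
Proof.
move=> Cf; have -> : (fun x => sphere_grad f x 0 i) =
   (fun x => grad f x 0 i - dot (grad f x) x * x 0 i).
  by apply/funext => x; rewrite !mxE.
move=> x; apply: continuous_atB; first exact: continuous_grad.
apply: continuous_atM; last exact: continuous_coord.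
apply: (@continuous_dot (grad f) id) => j; first exact: continuous_grad.
exact: continuous_coord.
Qed.

Lemma continuous_sphere_div (X : 'rV[R]_3 -> 'rV[R]_3) :
  (forall i, C1 (fun x => X x 0 i)) -> continuous (sphere_div X).
Proof.
by move=> CX; apply: continuous_sum => i; exact: continuous_sphere_grad.
Qed.

End Space.

(** * Latitude coordinates and zonal integrals *)

Section Zonal.
Variable R : realType.
Implicit Types (f g : 'rV[R]_3 -> R) (x y : 'rV[R]_3) (z t a b : R).
Local Notation mu := (@lebesgue_measure R).
Local Notation i0 := (ord0 : 'I_3).
Local Notation i1 := (@Ordinal 3 1 isT).
Local Notation i2 := (ord_max : 'I_3).

Lemma sum3E (V : nmodType) (F : 'I_3 -> V) : \sum_(i < 3) F i = F i0 + F i1 + F i2.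
Proof.
rewrite !big_ord_recl big_ord0 addr0 addrA.
by congr (_ + _ + _); congr F; exact: val_inj.
Qed.

Lemma dot3E x y : dot x y = x 0 i0 * y 0 i0 + x 0 i1 * y 0 i1 + x 0 i2 * y 0 i2.
Proof. exact: sum3E. Qed.

Lemma ord3P (P : 'I_3 -> Prop) : P i0 -> P i1 -> P i2 -> forall i, P i.
Proof.
move=> P0 P1 P2 [[|[|[|//]]] Hi].
- by rewrite (_ : Ordinal Hi = i0) //; exact: val_inj.
- by rewrite (_ : Ordinal Hi = i1) //; exact: val_inj.
- by rewrite (_ : Ordinal Hi = i2) //; exact: val_inj.
Qed.

Lemma dotC x y : dot x y = dot y x.
Proof. by rewrite !dot3E; ring. Qed.

Lemma sphere_point0 z t : sphere_point z t 0 i0 = Num.sqrt (1 - z ^+ 2) * cos t.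
Proof. by rewrite mxE. Qed.
Lemma sphere_point1 z t : sphere_point z t 0 i1 = Num.sqrt (1 - z ^+ 2) * sin t.
Proof. by rewrite mxE. Qed.
Lemma sphere_point2 z t : sphere_point z t 0 i2 = z.
Proof. by rewrite mxE. Qed.

Definition sphere_pointE := (sphere_point0, sphere_point1, sphere_point2).

Lemma itv_sqr_le1 z : -1 <= z <= 1 -> 0 <= 1 - z ^+ 2.
Proof. by move=> /andP[]; nra. Qed.

Lemma itv_sqr_lt1 z : -1 < z < 1 -> 0 < 1 - z ^+ 2.
Proof. by move=> /andP[]; nra. Qed.

Lemma sphere_pointP z t : -1 <= z <= 1 -> sphere (sphere_point z t).
Proof.
move=> z1; rewrite /sphere /= dot3E !sphere_pointE.
have := sqr_sqrtr (itv_sqr_le1 z1); have := cos2Dsin2 t.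
set r := Num.sqrt _; set c := cos t; set s := sin t => cs rr.
transitivity (r ^+ 2 * (c ^+ 2 + s ^+ 2) + z ^+ 2); first ring.
by rewrite cs rr; ring.
Qed.

(** Away from the poles the angle is the arc cosine of the normalized first
    coordinate, reflected when the second coordinate is negative. *)
Lemma sphere_point_surj x : sphere x -> -1 < height x < 1 ->
  exists2 t, t \in `[0, 2 * pi] & x = sphere_point (height x) t.
Proof.
rewrite /sphere /= dot3E /height; set z := x 0 i2 => xx z1.
have r0 := itv_sqr_lt1 z1.
have rr := sqr_sqrtr (ltW r0).
set r := Num.sqrt _ in rr.
have rp : 0 < r by rewrite sqrtr_gt0.
pose c := x 0 i0 / r; pose s := x 0 i1 / r.
have cr : r * c = x 0 i0 by rewrite /c mulrC divfK ?gt_eqF.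
have sr : r * s = x 0 i1 by rewrite /s mulrC divfK ?gt_eqF.
have cs : c ^+ 2 + s ^+ 2 = 1.
  have : r ^+ 2 * (c ^+ 2 + s ^+ 2) = r ^+ 2 * 1.
    rewrite mulr1; transitivity ((r * c) ^+ 2 + (r * s) ^+ 2); first ring.
    by rewrite cr sr rr; move: xx; rewrite -!expr2; lra.
  by apply: mulfI; rewrite gt_eqF // exprn_gt0.
have c1 : -1 <= c <= 1 by apply/andP; split; nra.
have [t tI [ct st]] : exists2 t, t \in `[0, 2 * pi] & cos t = c /\ sin t = s.
  have pi0 := pi_gt0 R; have a0 := acos_ge0 c1; have ap := acos_lepi c1.
  have s2 : s ^+ 2 = 1 - c ^+ 2 by move: cs; lra.
  case: (leP 0 s) => s0.
    exists (acos c); first by rewrite in_itv /= a0 /=; lra.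
    rewrite acosK // sin_acos //; split => //.
    by rewrite -s2 sqrtr_sqr ger0_norm.
  exists (2 * pi - acos c); first by rewrite in_itv /=; apply/andP; split; lra.
  have -> : 2 * pi - acos c = - acos c + pi *+ 2 by rewrite mulr2n; ring.
  rewrite cosD2pi sinD2pi cosN sinN acosK // sin_acos //; split => //.
  by rewrite -s2 sqrtr_sqr ltr0_norm // opprK.
exists t => //; apply/rowP; apply: ord3P; rewrite sphere_pointE -/z -/r.
- by rewrite ct cr.
- by rewrite st sr.
- by [].
Qed.

Lemma continuous_sphere_point : continuous (fun w : R * R => sphere_point w.1 w.2).
Proof.
have c1 : continuous (fun w : R * R => Num.sqrt (1 - w.1 ^+ 2)).
  move=> w; apply: (@continuous_comp _ _ _ (fun w : R * R => 1 - w.1 ^+ 2) Num.sqrt).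
    apply: continuous_atB; first exact: cst_continuous.
    by apply: continuous_atM; exact: cvg_fst.
  exact: sqrt_continuous.
have c2 (h : R -> R) : continuous h -> continuous (fun w : R * R => h w.2).
  move=> ch w; apply: (@continuous_comp _ _ _ snd h); first exact: cvg_snd.
  exact: ch.
have ext (h k : R * R -> R) w : h =1 k -> continuous_at w h -> continuous_at w k.
  by move=> /funext ->.
move=> w; apply: rV_continuous; apply: ord3P.
- apply: (ext _ _ _ (fun w => esym (sphere_point0 w.1 w.2))).
  apply: continuous_atM; first exact: c1.
  by apply: c2; exact: continuous_cos.
- apply: (ext _ _ _ (fun w => esym (sphere_point1 w.1 w.2))).
  apply: continuous_atM; first exact: c1.
  by apply: c2; exact: continuous_sin.
- apply: (ext _ _ _ (fun w => esym (sphere_point2 w.1 w.2))).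
  exact: cvg_fst.
Qed.

(** On the sphere this is the tangential gradient of the height, a vector of
    squared length [1 - z^2]. *)
Definition meridian x : 'rV[R]_3 := delta_mx 0 i2 - x 0 i2 *: x.
(** Velocity field of the rotation about the vertical axis. *)
Definition parallel x : 'rV[R]_3 := \row_(i < 3) [:: - x 0 i1; x 0 i0; 0]`_i.

Lemma dot_meridian f x : dot (meridian x) (grad f x) = sphere_grad f x 0 i2.
Proof.
rewrite /sphere_grad /meridian; move: (grad f x) => G.
by rewrite !dot3E !mxE /=; ring.
Qed.

Lemma is_derive_sphere_point_height z t i : -1 < z < 1 ->
  is_derive z 1 (fun s => sphere_point s t 0 i)
    (((1 - z ^+ 2)^-1 *: meridian (sphere_point z t)) 0 i).
Proof.
move=> z1; have z0 := itv_sqr_lt1 z1.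
have rp : Num.sqrt (1 - z ^+ 2) != 0 by rewrite gt_eqF // sqrtr_gt0.
have zE : (1 - z ^+ 2)^-1 = Num.sqrt (1 - z ^+ 2) ^- 2 by rewrite sqr_sqrtr // ltW.
have dr : is_derive z 1 (fun s => Num.sqrt (1 - s ^+ 2)) (- z / Num.sqrt (1 - z ^+ 2)).
  have d1 : is_derive z 1 (fun s : R => 1 - s ^+ 2) (- (2 * z)).
    have -> : (fun s : R => 1 - s ^+ 2) = cst 1 - (id : R -> R) ^+ 2.
      by apply/funext => s; rewrite /= !fctE.
    by apply: is_derive_eq; rewrite sub0r /= expr1 [_%:A]mulr1.
  have d2 := is_derive1_sqrt z0.
  have := @is_derive1_comp R Num.sqrt (fun s : R => 1 - s ^+ 2) z _ _ d2 d1.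
  by move=> /is_derive_congr; apply; field.
move: i; apply: ord3P.
- under eq_fun do rewrite sphere_pointE.
  apply: (is_derive_congr (is_derive_mulr (cos t) dr)); rewrite zE !mxE /=.
  by field.
- under eq_fun do rewrite sphere_pointE.
  apply: (is_derive_congr (is_derive_mulr (sin t) dr)); rewrite zE !mxE /=.
  by field.
- under eq_fun do rewrite sphere_pointE.
  apply: (is_derive_congr (is_derive_id z (1 : R))).
  rewrite !mxE /=; field; exact: lt0r_neq0.
Qed.

Lemma is_derive_sphere_point_angle z t i :
  is_derive t 1 (fun s => sphere_point z s 0 i) (parallel (sphere_point z t) 0 i).
Proof.
move: i; apply: ord3P.
- under eq_fun do rewrite sphere_pointE.
  apply: (is_derive_congr (is_derive_mull (Num.sqrt (1 - z ^+ 2)) (is_derive_cos t))).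
  by rewrite !mxE /= mulrN.
- under eq_fun do rewrite sphere_pointE.
  have := @is_deriveZ _ _ _ _ (Num.sqrt (1 - z ^+ 2)) _ _ _ (is_derive_sin t).
  by move=> /is_derive_congr; apply; rewrite !mxE.
- under eq_fun do rewrite sphere_pointE.
  by apply: (is_derive_congr (is_derive_cst z t (1 : R))); rewrite !mxE.
Qed.

Definition zonal f z := \int[mu]_(t in `[(0 : R), 2 * pi]) f (sphere_point z t).

Lemma sphere_intE f : sphere_int f = \int[mu]_(z in `[(-1)%R, 1%R]) zonal f z.
Proof. by []. Qed.

Lemma continuous_on_sphere_point f z : continuous f ->
  continuous (fun t => f (sphere_point z t)).
Proof.
move=> cf t; apply: (@continuous_comp _ _ _ (sphere_point z) f); last exact: cf.
apply: (@continuous_comp _ _ _ (fun t : R => (z, t)) (fun w => sphere_point w.1 w.2)).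
  have c1 : cst z @ t --> z by exact: cvg_cst.
  have c2 : (id : R -> R) @ t --> t by exact: cvg_id.
  exact: (cvg_pair c1 c2).
exact: continuous_sphere_point.
Qed.

Lemma continuous_on_sphere_point_height f t : continuous f ->
  continuous (fun z => f (sphere_point z t)).
Proof.
move=> cf z; apply: (@continuous_comp _ _ _ (fun z => sphere_point z t) f); last exact: cf.
apply: (@continuous_comp _ _ _ (fun z : R => (z, t)) (fun w => sphere_point w.1 w.2)).
  have c1 : cst t @ z --> t by exact: cvg_cst.
  have c2 : (id : R -> R) @ z --> z by exact: cvg_id.
  exact: (cvg_pair c2 c1).
exact: continuous_sphere_point.
Qed.

Lemma zonal_integrable f z : continuous f ->
  mu.-integrable `[(0 : R), 2 * pi] (EFin \o (fun t => f (sphere_point z t))).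
Proof. by move=> cf; apply: continuous_integrable; exact: continuous_on_sphere_point. Qed.

(** Provides the constant that dominates the integrands when limits and
    derivatives are taken under the angular integral. *)
Lemma sphere_point_bounded f a b : continuous f ->
  exists M, forall z t, z \in `[a, b] -> t \in `[0, 2 * pi] ->
    `|f (sphere_point z t)| <= M.
Proof.
move=> cf.
pose F (w : R * R) := f (sphere_point w.1 w.2).
have cF : continuous F.
  move=> w; apply: (@continuous_comp _ _ _ (fun w : R * R => sphere_point w.1 w.2) f).
    exact: continuous_sphere_point.
  exact: cf.
have K : compact (`[a, b]%classic `*` `[(0 : R), 2 * pi]%classic : set (R * R)).
  by apply: compact_setX; exact: segment_compact.
have FK : compact (F @` (`[a, b] `*` `[(0 : R), 2 * pi])).
  by apply: continuous_compact => //; exact: continuous_subspaceT.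
have [M [Mr HM]] := compact_bounded FK.
exists (M + 1) => z t zab tab.
by apply: (HM (M + 1)); [rewrite ltrDl|exists (z, t)].
Qed.

Lemma continuous_zonal f : continuous f -> continuous (zonal f).
Proof.
move=> cf z.
have [M HM] := sphere_point_bounded (z - 1) (z + 1) cf.
have := @continuity_under_integral R _ _ mu (fun z t => f (sphere_point z t))
  `[(0 : R), 2 * pi] _ (z - 1) (z + 1) _ _ (cst M) _ _.
apply => //.
- by move=> s _; exact: zonal_integrable.
- by apply: aeW => t _ s _; exact: continuous_on_sphere_point_height.
- by apply: continuous_integrable; exact: cst_continuous.
- move=> s; rewrite /= in_itv /= => /andP[s1 s2]; apply: aeW => t tI; apply: HM => //.
  by rewrite in_itv /= !ltW.
- by rewrite inE /= in_itv /=; apply/andP; split; lra.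
Qed.

(** The velocity of [sphere_point] in the height is the meridian vector divided
    by [1 - z^2], and pairing the meridian with the gradient gives the third
    component of the tangential gradient.  The form with [1 - z^2] factored out
    keeps the zonal integral on the right continuous up to the poles. *)
Lemma is_derive_zonal f z : C1 f -> -1 < z < 1 ->
  is_derive z 1 (zonal f) ((1 - z ^+ 2)^-1 * zonal (fun x => sphere_grad f x 0 i2) z).
Proof.
move=> Cf z1.
have cf := C1_continuous Cf.
have cg := @continuous_sphere_grad R f i2 Cf.
(* The derivative of the integrand blows up at the poles; it is dominated on a
   compact interval of heights strictly between them. *)
pose r := (1 + `|z|) / 2.
have zr : `|z| < 1 by rewrite ltr_norml; lra.
have r1 : r < 1 by rewrite /r; lra.
have r0 : 0 <= r by rewrite /r divr_ge0 // addr_ge0.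
have Hd (s t : R) : -1 < s < 1 -> is_derive s 1 (fun a => f (sphere_point a t))
    ((1 - s ^+ 2)^-1 * sphere_grad f (sphere_point s t) 0 i2).
  move=> s1; have := @is_derive_curve R f (fun a => sphere_point a t) _ s (Cf.1 _)
    (fun i => is_derive_sphere_point_height t i s1).
  move=> /is_derive_congr; apply; rewrite -dot_meridian /dot mulr_sumr; apply: eq_bigr => i _.
  by rewrite mxE mulrA.
have [M HM] := sphere_point_bounded (- r) r cg.
have Irs (s : R) : s \in `]- r, r[ -> -1 < s < 1.
  by rewrite in_itv /= => /andP[? ?]; apply/andP; split; lra.
have zI : `]- r, r[%classic z.
  rewrite /= in_itv /= -ltr_norml /r; lra.
have M0 : 0 <= M.
  apply: (le_trans (normr_ge0 _)); apply: (HM 0 0).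
    by rewrite in_itv /= oppr_le0 r0.
  by rewrite in_itv /= lexx mulr_ge0 // ltW // pi_gt0.
have d1E (s t : R) : s \in `]- r, r[ -> partial1of2 (fun z t => f (sphere_point z t)) s t =
     (1 - s ^+ 2)^-1 * sphere_grad f (sphere_point s t) 0 i2.
  by move=> /Irs s1; rewrite partial1of2E; exact: (@derive_val _ _ _ _ _ _ _ (Hd s t s1)).
have r2 : 0 < 1 - r ^+ 2 by nra.
have H1 (s : R) : `]- r, r[%classic s -> mu.-integrable `[(0 : R), 2 * pi] (EFin \o (fun t => f (sphere_point s t))).
  by move=> _; exact: zonal_integrable.
have H2 (s t : R) : `]- r, r[%classic s -> `[(0 : R), 2 * pi]%classic t ->
    derivable (fun a => f (sphere_point a t)) s 1.
  by move=> sI _; have [] := Hd s t (Irs s sI).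
have H3 : mu.-integrable `[(0 : R), 2 * pi] (EFin \o cst (M / (1 - r ^+ 2))).
  by apply: continuous_integrable; exact: cst_continuous.
have H4 (s t : R) : `]- r, r[%classic s -> `[(0 : R), 2 * pi]%classic t ->
    `|partial1of2 (fun z t => f (sphere_point z t)) s t| <= cst (M / (1 - r ^+ 2)) t.
  move=> /= sI tI; rewrite d1E // normrM mulrC.
  have s1 := itv_sqr_lt1 (Irs _ sI).
  have [sr1 sr2] : - r < s /\ s < r by move: sI; rewrite in_itv /= => /andP[].
  apply: ler_pM => //.
    by apply: HM => //; rewrite in_itv /= !ltW.
  rewrite ger0_norm ?invr_ge0 ?(ltW s1) //.
  by rewrite lef_pV2 ?posrE //; nra.
have mB : measurable (`[(0 : R), 2 * pi]%classic : set R) by exact: measurable_itv.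
have C0 : forall y : R, 0 <= cst (M / (1 - r ^+ 2)) y by move=> y; rewrite /= divr_ge0 // ltW.
have D := @derivable_under_integral R _ _ mu _ _ mB z (- r) r zI H1 H2 _ C0 H3 H4.
have E := @differentiation_under_integral R _ _ mu _ _ mB z (- r) r zI H1 H2 _ C0 H3 H4.
apply: DeriveDef; first exact: D.
rewrite -derive1E [LHS]E.
rewrite /zonal -RintegralZl //; last exact: (@zonal_integrable (fun x => sphere_grad f x 0 i2)).
by apply: eq_Rintegral => t _; rewrite d1E.
Qed.

End Zonal.

(** * The divergence theorem across latitudes *)

Section Divergence.
Variable R : realType.
Implicit Types (f g : 'rV[R]_3 -> R) (x y : 'rV[R]_3) (z t a b : R).
Local Notation mu := (@lebesgue_measure R).
Local Notation i0 := (ord0 : 'I_3).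
Local Notation i1 := (@Ordinal 3 1 isT).
Local Notation i2 := (ord_max : 'I_3).

Lemma dotZl (k : R) x y : dot (k *: x) y = k * dot x y.
Proof. by rewrite /dot mulr_sumr; apply: eq_bigr => i _; rewrite mxE mulrA. Qed.

Lemma sphere_divE (X : 'rV[R]_3 -> 'rV[R]_3) x (J := fun i => grad (fun y => X y 0 i) x) :
  sphere_div X x = J i0 0 i0 - dot (J i0) x * x 0 i0 + (J i1 0 i1 - dot (J i1) x * x 0 i1)
     + (J i2 0 i2 - dot (J i2) x * x 0 i2).
Proof.
rewrite /sphere_div sum3E /sphere_grad.
rewrite -!/(J _); move: (J i0) (J i1) (J i2) => A B C.
by rewrite !mxE.
Qed.

(** Tangency, [<X, x> = 0] on the sphere, differentiated along the meridian. *)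
Lemma tangent_meridian (X : 'rV[R]_3 -> 'rV[R]_3) (z t : R)
    (p := sphere_point z t) (J := fun i => grad (fun y => X y 0 i) p) :
  tangent_field X -> -1 < z < 1 ->
  dot (meridian p) (J i0) * p 0 i0 + dot (meridian p) (J i1) * p 0 i1 +
  dot (meridian p) (J i2) * p 0 i2 + dot (X p) (meridian p) = 0.
Proof.
move=> [CX tX] z1.
pose k := (1 - z ^+ 2)^-1.
have k0 : k != 0 by rewrite invr_eq0 gt_eqF // itv_sqr_lt1.
have dp i := is_derive_sphere_point_height t i z1.
have dX i : is_derive z 1 (fun s : R => X (sphere_point s t) 0 i)
    (k * dot (meridian p) (J i)).
  have := @is_derive_curve R (fun y => X y 0 i) (fun s => sphere_point s t) _ z
    ((CX i).1 _) dp.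
  by move=> /is_derive_congr; apply; rewrite dotZl.
pose F i : R -> R := (fun s => X (sphere_point s t) 0 i) * (fun s => sphere_point s t 0 i).
have dF i := is_deriveM (dX i) (dp i).
have dS := is_deriveD (is_deriveD (dF i0) (dF i1)) (dF i2).
have d0 : is_derive z 1 (F i0 + F i1 + F i2) 0.
  apply: (near_eq_is_derive _ (is_derive_cst (0 : R) z (1 : R))).
  have z1' : z \in `]-1, 1[ by rewrite in_itv.
  near=> s.
  have /tX : sphere (sphere_point s t).
    apply: sphere_pointP.
    have : s \in `]-1, 1[ by near: s; exact: near_in_itvoo.
    by rewrite in_itv /= => /andP[? ?]; rewrite !ltW.
  by rewrite dot3E.
have := @derive_val _ _ _ _ _ _ _ dS.
rewrite (@derive_val _ _ _ _ _ _ _ d0) => E.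
apply: (mulfI k0); rewrite mulr0 [RHS]E -/p -/k.
have mE i : (k *: meridian p) 0 i = k * meridian p 0 i by rewrite mxE.
rewrite !mE [dot (X p) _]dot3E.
rewrite -![_ *: _]/(_ * _).
set a := dot _ (J i0); set b := dot _ (J i1); set c := dot _ (J i2).
ring.
Unshelve. all: by end_near. Qed.

(** In the coordinates [(z, theta)], whose area density is constant, the
    divergence is [d_z X^z + d_theta X^theta], with [X^z] the third component.
    The statement computes [(1 - z^2) d_theta X^theta]. *)
Lemma sphere_div_angular (X : 'rV[R]_3 -> 'rV[R]_3) (z t : R) :
  tangent_field X -> -1 < z < 1 ->
  is_derive t 1
    (fun s => sphere_point z s 0 i0 * X (sphere_point z s) 0 i1 -
              sphere_point z s 0 i1 * X (sphere_point z s) 0 i0)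
    ((1 - z ^+ 2) * sphere_div X (sphere_point z t) -
      sphere_grad (fun y => X y 0 i2) (sphere_point z t) 0 i2).
Proof.
move=> tX z1.
have tm := tangent_meridian t tX z1.
have sp : sphere (sphere_point z t) by apply: sphere_pointP; case/andP: z1 => ? ?; rewrite !ltW.
have Xp := tX.2 _ sp.
have dp i := is_derive_sphere_point_angle z t i.
have dX i := @is_derive_curve R (fun y => X y 0 i) (fun s => sphere_point z s) _ t
    ((tX.1 i).1 _) dp.
have := is_deriveB (is_deriveM (dp i0) (dX i1)) (is_deriveM (dp i1) (dX i0)).
move=> /is_derive_congr; apply.
rewrite -dot_meridian sphere_divE.
move: {dp dX z1 tX} tm Xp sp; rewrite /sphere /=.
rewrite (_ : 1 - z ^+ 2 = 1 - sphere_point z t 0 i2 ^+ 2); last by rewrite sphere_point2.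
move: (sphere_point z t) => p.
move: (grad (fun y => X y 0 i0) p) (grad (fun y => X y 0 i1) p) (grad (fun y => X y 0 i2) p) (X p) => A B C V.
rewrite !dot3E -![_ *: _]/(_ * _) !mxE /=.
move: (A 0 i0) (A 0 i1) (A 0 i2) (B 0 i0) (B 0 i1) (B 0 i2) (C 0 i0) (C 0 i1) (C 0 i2)
  (p 0 i0) (p 0 i1) (p 0 i2) (V 0 i0) (V 0 i1) (V 0 i2).
move=> a0 a1 a2 b0 b1 b2 c0 c1 c2 p0 p1 p2 v0 v1 v2.
set TM := (Z in Z = 0 -> _); set XP := (Z in _ -> Z = 0 -> _).
set SP := (Z in _ -> _ -> Z = 1 -> _) => tm Xp sp.
apply/esym/subr0_eq.
(* The identity holds modulo unit length, tangency and its derivative along the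
   meridian; these are the cofactors. *)
transitivity ((a0 + b1) * (1 - SP) - p2 * TM + (1 - p2 ^+ 2) * XP).
  by rewrite /SP /TM /XP; ring.
by rewrite tm Xp sp; ring.
Qed.

(** The angular part of the divergence integrates to zero over a full turn. *)
Lemma zonal_sphere_div (X : 'rV[R]_3 -> 'rV[R]_3) z :
  tangent_field X -> -1 < z < 1 ->
  is_derive z 1 (zonal (fun x => X x 0 i2)) (zonal (sphere_div X) z).
Proof.
move=> tX z1; have CX := tX.1.
apply: (is_derive_congr (is_derive_zonal (CX i2) z1)).
have cg := @continuous_sphere_grad R _ i2 (CX i2).
have cd := continuous_sphere_div CX.
have z0 : 1 - z ^+ 2 != 0 by rewrite gt_eqF // itv_sqr_lt1.
apply: (mulfI z0); rewrite mulrA divff // mul1r.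
rewrite /zonal -RintegralZl //; last exact: zonal_integrable.
apply/esym/subr0_eq; rewrite -RintegralB //; last 2 first.
- apply: (@zonal_integrable _ (fun x => (1 - z ^+ 2) * sphere_div X x)) => x.
  by apply: continuous_atM; [exact: cst_continuous|exact: cd].
- exact: (@zonal_integrable _ (fun x => sphere_grad _ x 0 i2)).
pose H s := sphere_point z s 0 i0 * X (sphere_point z s) 0 i1 -
            sphere_point z s 0 i1 * X (sphere_point z s) 0 i0.
rewrite (@Rintegral_is_derive _ _ H).
- rewrite /H; have -> : sphere_point z (2 * pi) = sphere_point z 0; last by rewrite subrr.
  by apply/rowP => i; rewrite !mxE mulr_natl -[pi *+ 2]add0r cosD2pi sinD2pi.
- by rewrite mulr_ge0 // ltW // pi_gt0.
- apply: continuous_subspaceT.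
  apply: (@continuous_on_sphere_point _ (fun x => (1 - z ^+ 2) * sphere_div X x -
     sphere_grad (fun y => X y 0 i2) x 0 i2)) => x.
  apply: continuous_atB; last exact: cg.
  by apply: continuous_atM; [exact: cst_continuous|exact: cd].
- apply: continuous_subspaceT.
  apply: (@continuous_on_sphere_point _ (fun x => x 0 i0 * X x 0 i1 - x 0 i1 * X x 0 i0)) => x.
  by apply: continuous_atB; apply: continuous_atM;
    do ?[exact: continuous_coord|exact: C1_continuous (CX _) _].
- by move=> t _; exact: sphere_div_angular.
Qed.

(** At a pole the third component is, up to sign, the normal component. *)
Lemma zonal_tangent_pole (X : 'rV[R]_3 -> 'rV[R]_3) z :
  tangent_field X -> z ^+ 2 = 1 -> zonal (fun x => X x 0 i2) z = 0.
Proof.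
move=> [_ tX] z2.
rewrite /zonal; under eq_Rintegral => t _.
  have z1 : -1 <= z <= 1 by apply/andP; split; nra.
  have := tX _ (sphere_pointP t z1).
  rewrite dot3E !sphere_pointE z2 subrr sqrtr0 !mul0r !mulr0 !add0r => /eqP.
  rewrite mulf_eq0 => /orP[/eqP ->|/eqP z0]; last first.
    by move: z2; rewrite z0 expr0n /= => /eqP; rewrite eq_sym oner_eq0.
  over.
by rewrite Rintegral_cst // mul0r.
Qed.

Lemma integral_zonal_div (X : 'rV[R]_3 -> 'rV[R]_3) a b : tangent_field X ->
  -1 <= a -> a <= b -> b <= 1 ->
  \int[mu]_(z in `[a, b]) zonal (sphere_div X) z =
  zonal (fun x => X x 0 i2) b - zonal (fun x => X x 0 i2) a.
Proof.
move=> tX a1 ab b1; apply: Rintegral_is_derive => //.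
- by apply: continuous_subspaceT; apply: continuous_zonal; exact: continuous_sphere_div tX.1.
- by apply: continuous_subspaceT; apply: continuous_zonal; exact: C1_continuous (tX.1 _).
- move=> z; rewrite in_itv /= => /andP[az zb]; apply: zonal_sphere_div => //.
  by rewrite (le_lt_trans a1 az) (lt_le_trans zb b1).
Qed.

End Divergence.

(** * Mass and total variation of a pattern *)

Section Pattern.
Variable R : realType.
Implicit Types (f g : 'rV[R]_3 -> R) (x y : 'rV[R]_3) (s t a b : R).
Local Notation mu := (@lebesgue_measure R).
Local Notation i0 := (ord0 : 'I_3).
Local Notation i1 := (@Ordinal 3 1 isT).
Local Notation i2 := (ord_max : 'I_3).

(** Crossing the interface of index [i] adds [2 (-1)^i] to the sign; sortedness
    makes the interfaces below [s] an initial segment. *)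
Lemma alternating_count_step (z : seq R) s : sorted <%R z ->
  (-1) ^+ (count (fun y : R => y <= s) z).+1 =
  -1 + \sum_(0 <= i < size z) 2 * (-1) ^+ i * heaviside z`_i s :> R.
Proof.
elim: z => [|a z IH] sz; first by rewrite big_nil addr0 expr1.
have {}IH := IH (path_sorted sz).
rewrite /= big_nat_recl //= /heaviside /= expr0 mulr1.
case: (leP a s) => sa.
  rewrite add1n exprS IH mulr1 mulrDr mulr_sumr mulrNN mulr1 addrA.
  congr (_ + _); first ring.
  by apply: eq_bigr => i _; rewrite exprS; ring.
rewrite (_ : count _ _ = 0%N) ?addn0 ?expr1; last first.
  apply/eqP; rewrite eqn0Ngt -has_count; apply/hasPn => y yz.
  rewrite -ltNge (lt_trans sa) //.
  by move/(order_path_min lt_trans)/allP: sz => /(_ _ yz).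
rewrite mulr0 add0r big_nat big1 ?addr0 // => i /andP[_ iz].
rewrite leNgt (lt_trans sa) ?mulr0 //.
by move/(order_path_min lt_trans)/allP: sz => /(_ _ (mem_nth 0 iz)).
Qed.

Lemma interfaces_sorted n (z : n.-tuple R) : interfaces z -> sorted <%R z.
Proof.
by move=> /path_sorted; exact: (subseq_sorted lt_trans (subseq_rcons _ _)).
Qed.

Lemma interfaces_itv n (z : n.-tuple R) i : interfaces z -> -1 < tnth z i < 1.
Proof.
move=> iz.
have := iz; rewrite /interfaces rcons_path => /andP[].
move/(order_path_min lt_trans)/allP => /(_ _ (mem_tnth i z)) -> /= _.
have := iz; rewrite /interfaces => /path_sorted.
rewrite -(revK (rcons z 1)) rev_sorted rev_rcons /= => /(order_path_min _)/allP.
by move=> -> //; [move=> a b c ab ca; exact: lt_trans ca ab | rewrite mem_rev mem_tnth].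
Qed.

(** The pattern as a sum of jumps: in this form integrals against it are sums of
    integrals with one interface each as endpoint. *)
Definition profile n (z : n.-tuple R) s : R :=
  -1 + \sum_(i < n) 2 * (-1) ^+ i * heaviside (tnth z i) s.

Lemma pattern_profile n (z : n.-tuple R) x : interfaces z ->
  pattern z x = profile z (height x).
Proof.
move=> /interfaces_sorted sz; rewrite /pattern alternating_count_step // /profile.
rewrite size_tuple big_mkord; congr (_ + _).
by apply: eq_bigr => i _; rewrite -tnth_nth.
Qed.

Lemma Rintegral_steps n (c0 : R) (c a : 'I_n -> R) (h : R -> R) : continuous h ->
  (forall i, -1 <= a i <= 1) ->
  mu.-integrable `[(-1)%R, 1%R]
    (EFin \o (fun s => (c0 + \sum_(i < n) c i * heaviside (a i) s) * h s)) /\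
  \int[mu]_(s in `[(-1)%R, 1%R]) ((c0 + \sum_(i < n) c i * heaviside (a i) s) * h s) =
  c0 * \int[mu]_(s in `[(-1)%R, 1%R]) h s +
  \sum_(i < n) c i * \int[mu]_(s in `[a i, 1%R]) h s.
Proof.
move=> ch; have mI : measurable (`[(-1)%R, 1%R]%classic : set R) by exact: measurable_itv.
elim: n c a => [|n IH] c a aI.
  under [X in _ \o X]eq_fun do rewrite big_ord0 addr0.
  under eq_Rintegral do rewrite big_ord0 addr0.
  rewrite big_ord0 addr0; split.
    by apply: continuous_integrable => s; apply: continuous_atM; [exact: cst_continuous|exact: ch].
  by rewrite RintegralZl //; exact: continuous_integrable.
have [I1 E1] := IH (fun i => c (widen_ord (leqnSn n) i)) (fun i => a (widen_ord (leqnSn n) i)) (fun i => aI _).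
have cch : continuous (fun s => c ord_max * h s).
  by move=> s; apply: continuous_atM; [exact: cst_continuous|exact: ch].
have I2 := step_integrable (-1) 1 (a ord_max) cch.
have E s : (c0 + \sum_(i < n.+1) c i * heaviside (a i) s) * h s =
   (c0 + \sum_(i < n) c (widen_ord (leqnSn n) i) * heaviside (a (widen_ord (leqnSn n) i)) s) * h s +
   heaviside (a ord_max) s * (c ord_max * h s).
  by rewrite big_ord_recr /=; ring.
under [X in _ \o X]eq_fun do rewrite E.
under eq_Rintegral do rewrite E.
split; first exact: (integrableD _ I1 I2).
rewrite RintegralD // E1 Rintegral_step // RintegralZl //; last exact: continuous_integrable.
by rewrite big_ord_recr /= addrA.
Qed.

Lemma zonal_height_mul (h : R -> R) f s : continuous f ->
  zonal (fun x => h (height x) * f x) s = h s * zonal f s.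
Proof.
move=> cf; rewrite /zonal -RintegralZl //; last exact: zonal_integrable.
by apply: eq_Rintegral => t _; rewrite /height sphere_point2.
Qed.

Lemma sphere_int_pattern_sub (m : R) n (z : n.-tuple R) f :
  interfaces z -> continuous f ->
  sphere_int (fun x => (pattern z x - m) * f x) =
  (-1 - m) * (\int[mu]_(s in `[(-1)%R, 1%R]) zonal f s) +
  \sum_(i < n) 2 * (-1) ^+ i * \int[mu]_(s in `[tnth z i, 1%R]) zonal f s.
Proof.
move=> iz cf; rewrite sphere_intE.
have -> : (fun x => (pattern z x - m) * f x) = (fun x => (profile z (height x) - m) * f x).
  by apply/funext => x; rewrite pattern_profile.
under eq_Rintegral => s _.
  rewrite (zonal_height_mul (fun s => profile z s - m) s cf) /profile addrAC.
  over.
have aI i : -1 <= tnth z i <= 1.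
  by have /andP[? ?] := interfaces_itv i iz; rewrite !ltW.
by have [_ ->] := Rintegral_steps (-1 - m) (fun i : 'I_n => 2 * (-1) ^+ i)
  (continuous_zonal cf) aI.
Qed.

Lemma sphere_int_pattern n (z : n.-tuple R) f : interfaces z -> continuous f ->
  sphere_int (fun x => pattern z x * f x) =
  - (\int[mu]_(s in `[(-1)%R, 1%R]) zonal f s) +
  \sum_(i < n) 2 * (-1) ^+ i * \int[mu]_(s in `[tnth z i, 1%R]) zonal f s.
Proof.
move=> iz cf; have := sphere_int_pattern_sub 0 iz cf.
by rewrite subr0 mulN1r => <-; congr sphere_int; apply/funext => x; rewrite subr0.
Qed.

Lemma zonal_cst (c : R) s : zonal (fun=> c) s = 2 * pi * c.
Proof.
rewrite /zonal Rintegral_cst //= lebesgue_measure_itv /= lte_fin.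
by rewrite mulr_gt0 ?pi_gt0 // EFinN sube0 /= mulrC.
Qed.

Lemma Rintegral_cst_itv (c a b : R) : a <= b -> \int[mu]_(s in `[a, b]) c = (b - a) * c.
Proof.
move=> ab; rewrite Rintegral_cst //= lebesgue_measure_itv /= lte_fin.
move: ab; rewrite le_eqVlt => /predU1P[->|ab]; first by rewrite ltxx subrr /= mulr0 mul0r.
by rewrite ab -EFinD /= mulrC.
Qed.

Lemma mass_pattern n (z : n.-tuple R) : interfaces z ->
  mass (pattern z) = -1 + \sum_(i < n) (-1) ^+ i * (1 - tnth z i).
Proof.
move=> iz; rewrite /mass.
have -> : pattern z = (fun x => pattern z x * (fun=> 1) x).
  by apply/funext => x; rewrite mulr1.
rewrite sphere_int_pattern //; last exact: cst_continuous.
have E a : a <= 1 -> \int[mu]_(s in `[a, 1]) zonal (fun=> 1) s = (1 - a) * (2 * pi).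
  move=> a1; under eq_Rintegral do rewrite zonal_cst mulr1.
  exact: Rintegral_cst_itv.
rewrite E; last by lra.
under eq_bigr => i _.
  rewrite E; last by have /andP[_ /ltW] := interfaces_itv i iz.
  over.
have p0 : (pi : R) != 0 by rewrite gt_eqF // pi_gt0.
move: {E} (pi : R) p0 => c c0.
rewrite mulrDr; congr (_ + _); first by field.
by rewrite mulr_sumr; apply: eq_bigr => i _; field.
Qed.

Lemma sphere_int_pattern_div n (z : n.-tuple R) (X : 'rV[R]_3 -> 'rV[R]_3) :
  interfaces z -> tangent_field X ->
  sphere_int (fun x => pattern z x * sphere_div X x) =
  - \sum_(i < n) 2 * (-1) ^+ i * zonal (fun x => X x 0 i2) (tnth z i).
Proof.
move=> iz tX; rewrite sphere_int_pattern //; last exact: continuous_sphere_div tX.1.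
have P1 : zonal (fun x => X x 0 i2) 1 = 0 by apply: zonal_tangent_pole; rewrite ?expr1n.
have PN1 : zonal (fun x => X x 0 i2) (-1) = 0.
  by apply: zonal_tangent_pole; rewrite ?sqrrN ?expr1n.
have N11 : -1 <= 1 :> R by lra.
rewrite integral_zonal_div // P1 PN1.
rewrite subrr oppr0 add0r -sumrN; apply: eq_bigr => i _.
have /andP[z1 z2] := interfaces_itv i iz.
by rewrite integral_zonal_div ?(ltW z1) ?(ltW z2) // P1; ring.
Qed.

(** By tangency the third component is the pairing with the meridian vector,
    whose length is [sqrt (1 - s^2)]; Cauchy-Schwarz then applies. *)
Lemma tangent_height_bound (X : 'rV[R]_3 -> 'rV[R]_3) s t : tangent_field X ->
  (forall x, sphere x -> dot (X x) (X x) <= 1) -> -1 <= s <= 1 ->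
  `|X (sphere_point s t) 0 i2| <= Num.sqrt (1 - s ^+ 2).
Proof.
move=> [_ tX] X1 s1.
have sp := sphere_pointP t s1.
have := tX _ sp; have := X1 _ sp; rewrite !dot3E !sphere_pointE.
move: (X _ 0 i0) (X _ 0 i1) (X _ 0 i2) => a b c.
have r2 := sqr_sqrtr (itv_sqr_le1 s1).
have r0 : 0 <= Num.sqrt (1 - s ^+ 2) by exact: sqrtr_ge0.
have := cos2Dsin2 t.
set r := Num.sqrt _ in r2 r0 *; set u := cos t; set w := sin t => uw abc E.
have E2 : (c * s) ^+ 2 = r ^+ 2 * (a * u + b * w) ^+ 2.
  have -> : c * s = - (r * (a * u + b * w)) by lra.
  by rewrite sqrrN exprMn.
have CS : (a * u + b * w) ^+ 2 <= a ^+ 2 + b ^+ 2.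
  rewrite -[leRHS]mulr1 -uw.
  have := sqr_ge0 (a * w - b * u); nra.
have : c ^+ 2 <= r ^+ 2.
  have : (c * s) ^+ 2 <= r ^+ 2 * (1 - c ^+ 2).
    rewrite E2; apply: ler_wpM2l; first exact: sqr_ge0.
    by apply: (le_trans CS); lra.
  rewrite exprMn mulrBr mulr1 r2; lra.
by rewrite ler_norml => cr; apply/andP; split; nra.
Qed.


Lemma C1_invsqrt f : C1 f -> (forall x, 0 < f x) ->
  C1 (fun x => (Num.sqrt (f x))^-1).
Proof.
move=> Cf f0.
pose h' (s : R) : R := - (Num.sqrt s) ^- 2 * (2 * Num.sqrt s)^-1.
apply: (@C1_comp R (fun s => (Num.sqrt s)^-1) h' f Cf) => x.
  have s0 : Num.sqrt (f x) != 0 by rewrite gt_eqF // sqrtr_gt0.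
  have [dS dE] := is_derive1_sqrt (f0 x).
  apply: DeriveDef; first exact: derivableV.
  by rewrite deriveV // dE.
have s0 : Num.sqrt (f x) != 0 by rewrite gt_eqF // sqrtr_gt0.
have cV : continuous_at (f x) (fun s => (Num.sqrt s)^-1).
  by apply: cvgV => //; exact: sqrt_continuous.
have -> : h' = (fun s => (- 2^-1) * ((Num.sqrt s)^-1 * ((Num.sqrt s)^-1 * (Num.sqrt s)^-1))).
  by apply/funext => s; rewrite /h' !invfM; ring.
apply: continuous_atM; first exact: cst_continuous.
by do ?apply: continuous_atM.
Qed.

Lemma C1_cos f : C1 f -> C1 (fun x => cos (f x)).
Proof.
move=> Cf; apply: (C1_comp Cf (fun x => is_derive_cos (f x))) => x.
by apply: cvgN; exact: continuous_sin.
Qed.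

Lemma C1_meridian i : C1 (fun x => meridian x 0 i).
Proof.
have -> : (fun x => meridian x 0 i) = (fun x => (delta_mx 0 i2 : 'rV[R]_3) 0 i - x 0 i2 * x 0 i).
  by apply/funext => x; rewrite !mxE.
by apply: C1_sub; [exact: C1_cst|apply: C1_mul; exact: C1_coord].
Qed.

Section OptimalField.
Variables (n : nat) (z : n.-tuple R).

(** Lagrange interpolation of the index of an interface: [cos (pi * node_index)]
    is bounded by 1 and alternates between 1 and -1 at the interfaces. *)
Definition node_index x : R := \sum_(i < n)
  i%:R * \prod_(j < n | j != i) ((height x - tnth z j) / (tnth z i - tnth z j)).

Definition axis_dist2 x : R := x 0 i0 * x 0 i0 + x 0 i1 * x 0 i1.

(** With [r = axis_dist2 x], equal to [1 - z^2] on the sphere, the function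
    [1 / sqrt (touching x)] is a minorant of [1 / sqrt r] that touches it at
    each interface and, unlike [1 / sqrt r], is regular on the axis. *)
Definition touching x : R := axis_dist2 x +
  \prod_(j < n) ((axis_dist2 x - (1 - tnth z j ^+ 2)) * (axis_dist2 x - (1 - tnth z j ^+ 2))).

(** A regular field, tangent to the sphere and of length at most 1 there, that
    points along the meridians with length exactly 1, in alternating directions,
    on the interfaces. *)
Definition optimal_field x : 'rV[R]_3 :=
  (- cos (pi * node_index x) * (Num.sqrt (touching x))^-1) *: meridian x.

Hypothesis iz : interfaces z.

Lemma node_indexE x k : height x = tnth z k -> node_index x = k%:R.
Proof.
move=> hx.
have inj : injective (tnth z).
  by apply/tuple_uniqP/lt_sorted_uniq/interfaces_sorted.
rewrite /node_index (bigD1 k) //= [X in _ + X]big1 => [|j jk]; last first.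
  rewrite (bigD1 k) /=; last by rewrite eq_sym.
  by rewrite hx subrr mul0r mul0r mulr0.
rewrite addr0 hx big1 ?mulr1 // => j jk; rewrite divff // subr_eq0.
by apply: contraNneq jk => /inj ->.
Qed.

Lemma axis_dist2_ge0 x : 0 <= axis_dist2 x.
Proof. by rewrite /axis_dist2 -!expr2 addr_ge0 // sqr_ge0. Qed.

Lemma axis_dist2_sphere x : sphere x -> axis_dist2 x = 1 - height x ^+ 2.
Proof. by rewrite /sphere /= dot3E /axis_dist2 /height => <-; ring. Qed.

Lemma touching_ge x : axis_dist2 x <= touching x.
Proof. by rewrite lerDl; apply: prodr_ge0 => j _; rewrite -expr2 sqr_ge0. Qed.

(** On the axis every factor of the product is the square of some
    [1 - z_j^2 > 0]. *)
Lemma touching_gt0 x : 0 < touching x.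
Proof.
have := touching_ge x; have := axis_dist2_ge0 x; rewrite le_eqVlt => /predU1P[E _|]; last exact: lt_le_trans.
rewrite /touching -E add0r; apply: prodr_gt0 => j _.
have /itv_sqr_lt1 := interfaces_itv j iz; nra.
Qed.

Lemma touchingE x k : sphere x -> height x = tnth z k -> touching x = 1 - tnth z k ^+ 2.
Proof.
move=> sx hx; rewrite /touching axis_dist2_sphere // hx (bigD1 k) //=.
by rewrite subrr !mul0r addr0.
Qed.

Lemma optimal_field_tangent : tangent_field optimal_field.
Proof.
split=> [i|x].
  have -> : (fun x => optimal_field x 0 i) = (fun x =>
     - cos (pi * node_index x) * (Num.sqrt (touching x))^-1 * meridian x 0 i).
    by apply/funext => x; rewrite /optimal_field mxE.
  have Ca : C1 axis_dist2 by apply: C1_add; apply: C1_mul; exact: C1_coord.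
  apply: C1_mul; last exact: C1_meridian.
  apply: C1_mul.
    apply/C1_opp/C1_cos/C1_mul; first exact: C1_cst.
    apply: C1_sum => j; apply: C1_mul; first exact: C1_cst.
    apply: C1_prod => k; apply: C1_mul; last exact: C1_cst.
    by apply: C1_sub; [exact: C1_coord|exact: C1_cst].
  apply: C1_invsqrt; last exact: touching_gt0.
  apply: C1_add => //; apply: C1_prod => j.
  by apply: C1_mul; apply: C1_sub => //; exact: C1_cst.
rewrite /sphere /optimal_field /= dotZl !dot3E !mxE /= => xx.
apply/eqP; rewrite mulf_eq0; apply/orP; right; apply/eqP.
move: (x 0 i0) (x 0 i1) (x 0 i2) xx => a b c xx.
transitivity (c * (1 - (a * a + b * b + c * c))); first ring.
by rewrite xx subrr mulr0.
Qed.

Lemma optimal_field_le1 x : sphere x -> dot (optimal_field x) (optimal_field x) <= 1.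
Proof.
move=> sx; rewrite /optimal_field dotZl dotC dotZl.
have -> : dot (meridian x) (meridian x) = axis_dist2 x.
  rewrite axis_dist2_sphere //; move: sx; rewrite /sphere /= /height !dot3E !mxE /=.
  move: (x 0 i0) (x 0 i1) (x 0 i2) => a b c xx.
  transitivity (1 - 2 * c ^+ 2 + c ^+ 2 * (a * a + b * b + c * c)); first ring.
  by rewrite xx; ring.
have t0 := touching_gt0 x.
have := sqr_sqrtr (ltW t0).
have r0 : 0 < Num.sqrt (touching x) by rewrite sqrtr_gt0.
set r := Num.sqrt _ in r0 *; set c := cos _ => r2.
have c1 : c ^+ 2 <= 1 by rewrite -(cos2Dsin2 (pi * node_index x)) lerDl sqr_ge0.
have -> : - c * r^-1 * (- c * r^-1 * axis_dist2 x) = c ^+ 2 * (axis_dist2 x / r ^+ 2).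
  by field; rewrite gt_eqF.
rewrite -[leRHS]mulr1; apply: ler_pM => //; first exact: sqr_ge0.
  by rewrite divr_ge0 ?axis_dist2_ge0 // sqr_ge0.
by rewrite r2 ler_pdivrMr // mul1r touching_ge.
Qed.

Lemma cos_pi_nat k : cos (pi * k%:R) = (-1) ^+ k :> R.
Proof.
elim: k => [|k IH]; first by rewrite mulr0 cos0.
by rewrite -natr1 mulrDr mulr1 cosDpi IH exprS mulN1r.
Qed.

(** The sign is opposite to that of the jump of the pattern, so that all fluxes
    contribute positively to the total variation. *)
Lemma zonal_optimal_field k : zonal (fun x => optimal_field x 0 i2) (tnth z k) =
  - (2 * pi * (-1) ^+ k * Num.sqrt (1 - tnth z k ^+ 2)).
Proof.
have zk := interfaces_itv k iz.
have r0 := itv_sqr_lt1 zk.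
have s0 : Num.sqrt (1 - tnth z k ^+ 2) != 0 by rewrite gt_eqF // sqrtr_gt0.
transitivity (zonal (fun=> - ((-1) ^+ k * Num.sqrt (1 - tnth z k ^+ 2))) (tnth z k)); last first.
  by rewrite zonal_cst; ring.
apply: eq_Rintegral => t _.
have sx : sphere (sphere_point (tnth z k) t).
  by apply: sphere_pointP; case/andP: zk => ? ?; rewrite !ltW.
have hx : height (sphere_point (tnth z k) t) = tnth z k by rewrite /height sphere_point2.
rewrite /optimal_field !mxE (node_indexE hx) (touchingE sx hx) cos_pi_nat /=.
have := sqr_sqrtr (ltW r0); move: s0; set r := Num.sqrt _ => s0 rr.
have -> : 1 - tnth z k * tnth z k = r ^+ 2 by rewrite rr expr2.
by field.
Qed.

End OptimalField.

(** Each jump has height 2, and the flux of an admissible field through the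
    parallel at height [z_i] is at most its length [2 pi sqrt (1 - z_i^2)]. *)
Theorem total_variation_pattern n (z : n.-tuple R) : interfaces z ->
  total_variation (pattern z) =
  (4 * pi * \sum_(i < n) Num.sqrt (1 - tnth z i ^+ 2))%:E.
Proof.
move=> iz; apply/eqP; rewrite eq_le; apply/andP; split.
  apply: ub_ereal_sup => _ [X [tX X1] <-]; rewrite lee_fin.
  rewrite sphere_int_pattern_div // -sumrN mulr_sumr; apply: ler_sum => i _.
  have zi := interfaces_itv i iz.
  have zi' : -1 <= tnth z i <= 1 by case/andP: zi => ? ?; rewrite !ltW.
  have B : `|zonal (fun x => X x 0 i2) (tnth z i)| <= 2 * pi * Num.sqrt (1 - tnth z i ^+ 2).
    have c2 : continuous (fun x => X x 0 i2) by exact: C1_continuous (tX.1 _).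
    rewrite -(zonal_cst _ (tnth z i)) /zonal.
    apply: le_trans (le_normr_Rintegral _ (zonal_integrable _ c2)) _ => //.
    apply: le_Rintegral => //.
    - apply: (@zonal_integrable _ (fun x => `|X x 0 i2|)) => x.
      by apply: continuous_at_norm; exact: c2.
    - by apply: continuous_integrable; exact: cst_continuous.
    - by move=> t _; exact: tangent_height_bound.
  move: B; set F := zonal _ _; rewrite ler_norml => /andP[F1 F2].
  have -> : 4 * pi * Num.sqrt (1 - tnth z i ^+ 2) = 2 * (2 * pi * Num.sqrt (1 - tnth z i ^+ 2)) by ring.
  move: F1 F2; set S := 2 * pi * _ => F1 F2.
  by rewrite -signr_odd; case: (odd i); rewrite ?expr0 ?expr1; lra.
apply: ereal_sup_ubound; exists (optimal_field z).
  by split; [exact: optimal_field_tangent|exact: optimal_field_le1].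
congr _%:E; rewrite sphere_int_pattern_div //; last exact: optimal_field_tangent.
rewrite -sumrN mulr_sumr; apply: eq_bigr => i _.
rewrite zonal_optimal_field //.
have := sqrr_sign R i; move: ((-1) ^+ i) => e e2.
transitivity (e ^+ 2 * (4 * pi * Num.sqrt (1 - tnth z i ^+ 2))); first ring.
by rewrite e2 mul1r.
Qed.

End Pattern.

(** * The Poisson equation and the nonlocal energy *)

Section Poisson.
Variable R : realType.
Implicit Types (f g : 'rV[R]_3 -> R) (x y : 'rV[R]_3) (s t a b m : R).
Local Notation mu := (@lebesgue_measure R).
Local Notation i0 := (ord0 : 'I_3).
Local Notation i1 := (@Ordinal 3 1 isT).
Local Notation i2 := (ord_max : 'I_3).

(** Derivative [g] of the zonal potential of the step [a <= s] minus its mean,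
    that is [- ((1 - s^2) g)' = heaviside a s - (1 - a) / 2].  Hence
    [(1 - s^2) g] is [(1 - a) (1 + s) / 2] below [a] and [(1 + a) (1 - s) / 2]
    above.  Clipping [s] at [a] in each denominator gives one formula that is
    continuous on the whole line, beyond the poles too. *)
Definition step_slope a s : R :=
  (1 - a) / (2 * (1 - Num.min s a)) + (1 + a) / (2 * (1 + Num.max s a)) - 2^-1.

Lemma continuous_step_slope a : -1 < a < 1 -> continuous (step_slope a).
Proof.
move=> /andP[a1 a2] s.
have cm : continuous_at s (fun s => Num.min s a).
  by apply: continuous_min; [exact: cvg_id|exact: cst_continuous].
have cM : continuous_at s (fun s => Num.max s a).
  by apply: continuous_max; [exact: cvg_id|exact: cst_continuous].
have m1 : Num.min s a <= a by rewrite ge_min lexx orbT.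
have m2 : a <= Num.max s a by rewrite le_max lexx orbT.
apply: continuous_atB; last exact: cst_continuous.
apply: continuous_atD; apply: continuous_atM; try exact: cst_continuous.
  apply: continuous_atV; first by rewrite gt_eqF // mulr_gt0 //; lra.
  apply: continuous_atM; first exact: cst_continuous.
  by apply: continuous_atB => //; exact: cst_continuous.
apply: continuous_atV; first by rewrite gt_eqF // mulr_gt0 //; lra.
apply: continuous_atM; first exact: cst_continuous.
by apply: continuous_atD => //; exact: cst_continuous.
Qed.

(** Here [H] and [K] stand for the zonal integrals of a test function and of the
    third component of its gradient, so that [K = (1 - s^2) H'].  An integration
    by parts on either side of [a] leaves opposite boundary terms at [a], and
    none at the poles. *)
Lemma step_slope_weak (H K : R -> R) a : -1 < a < 1 ->
  continuous H -> continuous K ->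
  (forall s, -1 < s < 1 -> is_derive s 1 H ((1 - s ^+ 2)^-1 * K s)) ->
  \int[mu]_(s in `[(-1)%R, 1%R]) (step_slope a s * K s) =
  (\int[mu]_(s in `[a, 1]) H s) - (1 - a) / 2 * \int[mu]_(s in `[(-1)%R, 1%R]) H s.
Proof.
move=> a1 cH cK dH; have [a0 a2] := andP a1.
have cG : continuous (fun s => step_slope a s * K s).
  by move=> s; apply: continuous_atM; [exact: continuous_step_slope|exact: cK].
have [P dP] := continuous_primitive cH.
have cP := is_derive_continuous dP.
have IH b c : b <= c -> \int[mu]_(s in `[b, c]) H s = P c - P b.
  by move=> bc; apply: Rintegral_is_derive => //; exact: continuous_subspaceT.
have N11 : -1 <= 1 :> R by lra.
rewrite (Rintegral_cat cG (ltW a0) (ltW a2)) (IH a) ?(ltW a2) // (IH (-1)) //.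
(* Primitives of the integrand below and above the step. *)
pose Phi s := (1 - a) / 2 * ((1 + s) * H s - P s).
pose Psi s := (1 + a) / 2 * ((1 - s) * H s + P s).
have dlin (c s : R) : is_derive s 1 (fun s : R => 1 + c * s) c.
  apply: (is_derive_congr (is_deriveD (is_derive_cst (1 : R) s 1)
     (is_derive_mull c (is_derive_id s (1 : R))))).
  by rewrite add0r mulr1.
have dlin1 s : is_derive s 1 (fun s : R => 1 + s) 1.
  by have := dlin 1 s; under eq_fun do rewrite mul1r.
have dlin2 s : is_derive s 1 (fun s : R => 1 - s) (-1).
  by have := dlin (-1) s; under eq_fun do rewrite mulN1r.
have clin1 : continuous (fun s : R => 1 + s) by exact: is_derive_continuous dlin1.
have clin2 : continuous (fun s : R => 1 - s) by exact: is_derive_continuous dlin2.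
have cPhi : continuous Phi.
  move=> s; apply: continuous_atM; first exact: cst_continuous.
  apply: continuous_atB; last exact: cP.
  by apply: continuous_atM; [exact: clin1|exact: cH].
have cPsi : continuous Psi.
  move=> s; apply: continuous_atM; first exact: cst_continuous.
  apply: continuous_atD; last exact: cP.
  by apply: continuous_atM; [exact: clin2|exact: cH].
have dPhi s : -1 < s -> s < a -> is_derive s 1 Phi (step_slope a s * K s).
  move=> s1 s2; have s11 : -1 < s < 1 by rewrite s1 (lt_trans s2).
  have D := is_derive_mull ((1 - a) / 2)
    (is_deriveB (is_deriveM (dlin1 s) (dH s s11)) (dP s)).
  apply: (is_derive_congr D).
  rewrite /step_slope (min_l (ltW s2)) (max_r (ltW s2)) -![_ *: _]/(_ * _).
  have n1 : 1 - s != 0 by rewrite gt_eqF //; lra.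
  have n2 : 1 + s != 0 by rewrite gt_eqF //; lra.
  have n3 : 1 + a != 0 by rewrite gt_eqF //; lra.
  rewrite (_ : 1 - s ^+ 2 = (1 - s) * (1 + s)); last by ring.
  by field; rewrite n1 n2 n3.
have dPsi s : a < s -> s < 1 -> is_derive s 1 Psi (step_slope a s * K s).
  move=> s1 s2; have s11 : -1 < s < 1 by rewrite s2 (lt_trans _ s1).
  have D := is_derive_mull ((1 + a) / 2)
    (is_deriveD (is_deriveM (dlin2 s) (dH s s11)) (dP s)).
  apply: (is_derive_congr D).
  rewrite /step_slope (min_r (ltW s1)) (max_l (ltW s1)) -![_ *: _]/(_ * _).
  have n1 : 1 - s != 0 by rewrite gt_eqF //; lra.
  have n2 : 1 + s != 0 by rewrite gt_eqF //; lra.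
  have n3 : 1 - a != 0 by rewrite gt_eqF //; lra.
  rewrite (_ : 1 - s ^+ 2 = (1 - s) * (1 + s)); last by ring.
  by field; rewrite n1 n2 n3.
have EPhi : \int[mu]_(s in `[(-1)%R, a]) (step_slope a s * K s) = Phi a - Phi (-1).
  apply: Rintegral_is_derive; [exact: ltW|exact: continuous_subspaceT..|].
  by move=> s; rewrite in_itv /= => /andP[]; exact: dPhi.
have EPsi : \int[mu]_(s in `[a, 1]) (step_slope a s * K s) = Psi 1 - Psi a.
  apply: Rintegral_is_derive; [exact: ltW|exact: continuous_subspaceT..|].
  by move=> s; rewrite in_itv /= => /andP[]; exact: dPsi.
rewrite EPhi EPsi.
by rewrite /Phi /Psi; field.
Qed.

Lemma Rintegral_lin_comb n (c : 'I_n -> R) (h : 'I_n -> R -> R) a b :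
  (forall i, continuous (h i)) ->
  \int[mu]_(s in `[a, b]) (\sum_(i < n) c i * h i s) =
  \sum_(i < n) c i * \int[mu]_(s in `[a, b]) h i s.
Proof.
elim: n c h => [|n IH] c h ch.
  rewrite big_ord0; under eq_Rintegral do rewrite big_ord0.
  by rewrite Rintegral_cst // mul0r.
under eq_Rintegral do rewrite big_ord_recl.
have cs : continuous (fun s => \sum_(i < n) c (lift ord0 i) * h (lift ord0 i) s).
  move=> s; apply: continuous_at_sum => i.
  by apply: continuous_atM; [exact: cst_continuous|exact: ch].
have c0 : continuous (fun s => c ord0 * h ord0 s).
  by move=> s; apply: continuous_atM; [exact: cst_continuous|exact: ch].
rewrite RintegralD //; try exact: continuous_integrable.
by rewrite RintegralZl ?IH ?big_ord_recl //; exact: continuous_integrable.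
Qed.

Lemma sphere_grad_height (V V' : R -> R) x :
  is_derive (height x) 1 V (V' (height x)) ->
  sphere_grad (fun y => V (height y)) x = V' (height x) *: meridian x.
Proof.
move=> dV.
have gE : grad (fun y => V (height y)) x = V' (height x) *: delta_mx 0 i2.
  apply/rowP => i; rewrite !mxE.
  have D := is_derive_comp1 (delta_mx 0 i) ((C1_coord R i2).1 x) dV.
  by rewrite (@derive_val _ _ _ _ _ _ _ D) derive_coord mxE /= eq_sym.
rewrite /sphere_grad gE dotZl /meridian scalerBr scalerA; congr (_ - _ *: _).
by congr (_ * _); rewrite dot3E !mxE /=; ring.
Qed.

Lemma dot_sphere_grad_normal f x : sphere x -> dot x (sphere_grad f x) = 0.
Proof.
rewrite /sphere_grad /sphere /= => xx.
move: (grad f x) => G.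
have -> : dot x (G - dot G x *: x) = dot G x * (1 - dot x x).
  by rewrite !dot3E !mxE; ring.
by rewrite xx subrr mulr0.
Qed.

Lemma dot_meridian_sphere_grad f x : sphere x ->
  dot (meridian x) (sphere_grad f x) = sphere_grad f x 0 i2.
Proof.
move=> sx; have := dot_sphere_grad_normal f sx.
rewrite /meridian; move: (sphere_grad f x) => G.
rewrite !dot3E !mxE /= => E.
transitivity (G 0 i2 - x 0 i2 * (x 0 i0 * G 0 i0 + x 0 i1 * G 0 i1 + x 0 i2 * G 0 i2)).
  ring.
by rewrite E mulr0 subr0.
Qed.

Lemma eq_sphere_int f g : (forall x, sphere x -> f x = g x) ->
  sphere_int f = sphere_int g.
Proof.
move=> fg; apply: eq_Rintegral => s; rewrite inE /= in_itv /= => s1.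
by apply: eq_Rintegral => t _; apply/fg/sphere_pointP.
Qed.

(** The charge [u - m] is a sum of jumps [2 (-1)^i] at the [z_i] minus the
    average of each jump, by the mass constraint; the step potentials superpose. *)
Lemma poisson_height m n (z : n.-tuple R) : interfaces z -> mass (pattern z) = m ->
  exists V V' : R -> R, [/\ continuous V', forall s, is_derive s 1 V (V' s) &
    poisson m (pattern z) (fun x => V (height x))].
Proof.
move=> iz mz.
pose V' s := \sum_(i < n) (2 * (-1) ^+ i) * step_slope (tnth z i) s.
have cg i := continuous_step_slope (interfaces_itv i iz).
have cV' : continuous V'.
  move=> s; apply: continuous_at_sum => i.
  by apply: continuous_atM; [exact: cst_continuous|exact: cg].
have [V dV] := continuous_primitive cV'.
exists V, V'; split; [exact: cV'|exact: dV|split].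
  exact: (C1_comp (C1_coord R i2) (fun x => dV _) (fun x => cV' _)).
move=> eta Ceta; have ceta := C1_continuous Ceta.
rewrite sphere_int_pattern_sub //.
pose K := zonal (fun x => sphere_grad eta x 0 i2).
have cge := @continuous_sphere_grad R eta i2 Ceta.
have cK : continuous K by exact: continuous_zonal.
transitivity (\int[mu]_(s in `[(-1)%R, 1%R]) (V' s * K s)).
  rewrite (@eq_sphere_int _ (fun x => V' (height x) * sphere_grad eta x 0 i2)); last first.
    by move=> x sx; rewrite (sphere_grad_height (dV _)) dotZl dot_meridian_sphere_grad.
  rewrite sphere_intE; apply: eq_Rintegral => s _.
  exact: (zonal_height_mul V' s cge).
transitivity (\int[mu]_(s in `[(-1)%R, 1%R])
   (\sum_(i < n) (2 * (-1) ^+ i) * (step_slope (tnth z i) s * K s))).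
  apply: eq_Rintegral => s _; rewrite /V' mulr_suml; apply: eq_bigr => i _.
  by rewrite mulrA.
rewrite Rintegral_lin_comb; last first.
  by move=> i s; apply: continuous_atM; [exact: cg|exact: cK].
have dH s : -1 < s < 1 -> is_derive s 1 (zonal eta) ((1 - s ^+ 2)^-1 * K s).
  by move=> s1; exact: is_derive_zonal.
under eq_bigr => i _ do
  rewrite (step_slope_weak (interfaces_itv i iz) (continuous_zonal ceta) cK dH).
rewrite -mz mass_pattern //.
set I := \int[mu]_(s in `[(-1)%R, 1%R]) _.
under eq_bigr do rewrite mulrBr.
rewrite sumrB addrC; congr (_ + _).
rewrite [X in X * I](_ : _ = - \sum_(i < n) (-1) ^+ i * (1 - tnth z i)); last by ring.
by rewrite mulNr mulr_suml; congr (- _); apply: eq_bigr => i _; field.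
Qed.

Lemma sphere_intD f g : continuous f -> continuous g ->
  sphere_int (fun x => f x + g x) = sphere_int f + sphere_int g.
Proof.
move=> cf cg; rewrite !sphere_intE -RintegralD //; last 2 first.
- by apply: continuous_integrable; exact: continuous_zonal.
- by apply: continuous_integrable; exact: continuous_zonal.
by apply: eq_Rintegral => s _; rewrite /zonal RintegralD //; exact: zonal_integrable.
Qed.

Lemma sphere_intZ (k : R) f : continuous f ->
  sphere_int (fun x => k * f x) = k * sphere_int f.
Proof.
move=> cf; rewrite !sphere_intE -RintegralZl //; last first.
  by apply: continuous_integrable; exact: continuous_zonal.
by apply: eq_Rintegral => s _; rewrite /zonal RintegralZl //; exact: zonal_integrable.
Qed.

(** The Dirichlet form of the sphere. *)
Definition dirichlet f g := sphere_int (fun x => dot (sphere_grad f x) (sphere_grad g x)).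

Definition grad_gap f g x :=
  dot (sphere_grad f x - sphere_grad g x) (sphere_grad f x - sphere_grad g x).

Lemma dot_ge0 x : 0 <= dot x x.
Proof. by apply: sumr_ge0 => i _; rewrite -expr2 sqr_ge0. Qed.

Lemma dot_eq0 x : dot x x = 0 -> x = 0.
Proof.
move=> /eqP; rewrite psumr_eq0 => [/allP x0|i _]; last by rewrite -expr2 sqr_ge0.
apply/rowP => i; rewrite mxE; apply/eqP.
by have := x0 i (mem_index_enum i); rewrite -expr2 sqrf_eq0.
Qed.

Lemma continuous_dot_sphere_grad f g : C1 f -> C1 g ->
  continuous (fun x => dot (sphere_grad f x) (sphere_grad g x)).
Proof. by move=> Cf Cg; apply: continuous_dot => i; exact: continuous_sphere_grad. Qed.

Lemma continuous_grad_gap f g : C1 f -> C1 g -> continuous (grad_gap f g).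
Proof.
move=> Cf Cg.
have c i : continuous (fun x => (sphere_grad f x - sphere_grad g x) 0 i).
  have -> : (fun x => (sphere_grad f x - sphere_grad g x) 0 i) =
    (fun x => sphere_grad f x 0 i - sphere_grad g x 0 i).
    by apply/funext => x; rewrite mxE [X in _ + X]mxE.
  by move=> x; apply: continuous_atB; exact: continuous_sphere_grad.
exact: continuous_dot.
Qed.

Lemma sphere_int_grad_gap f g : C1 f -> C1 g ->
  sphere_int (grad_gap f g) = dirichlet f f - 2 * dirichlet f g + dirichlet g g.
Proof.
move=> Cf Cg.
have cff := continuous_dot_sphere_grad Cf Cf.
have cfg := continuous_dot_sphere_grad Cf Cg.
have cgg := continuous_dot_sphere_grad Cg Cg.
have c2 : continuous (fun x => -2 * dot (sphere_grad f x) (sphere_grad g x)).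
  by move=> x; apply: continuous_atM; [exact: cst_continuous|exact: cfg].
have -> : grad_gap f g = (fun x => dot (sphere_grad f x) (sphere_grad f x) +
    -2 * dot (sphere_grad f x) (sphere_grad g x) + dot (sphere_grad g x) (sphere_grad g x)).
  apply/funext => x; rewrite /grad_gap.
  move: (sphere_grad f x) (sphere_grad g x) => A B.
  by rewrite !dot3E !mxE; ring.
rewrite sphere_intD // ?sphere_intD // ?sphere_intZ //; first by rewrite mulNr.
by move=> x; apply: continuous_atD; [exact: cff|exact: c2].
Qed.

Lemma sphere_int_ge0 f : (forall x, 0 <= f x) -> 0 <= sphere_int f.
Proof. by move=> f0; do 2 (apply: Rintegral_ge0 => ? _). Qed.

Lemma dirichletC f g : dirichlet f g = dirichlet g f.
Proof. by apply: eq_sphere_int => x _; exact: dotC. Qed.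

Lemma poissonE m u f g : poisson m u f -> C1 g ->
  dirichlet f g = sphere_int (fun x => (u x - m) * g x).
Proof. by move=> [_ wf] Cg; exact: wf. Qed.

(** Each solution is an admissible test function for the other. *)
Lemma poisson_dirichlet m u f g : poisson m u f -> poisson m u g ->
  dirichlet f f = dirichlet f g.
Proof.
move=> pf pg; have [Cf _] := pf; rewrite [RHS]dirichletC.
by rewrite (poissonE pf Cf) (poissonE pg Cf).
Qed.

(** The energy is that of any solution, whichever one the definition picks. *)
Lemma nonlocal_energyE m u f : poisson m u f -> nonlocal_energy m u = dirichlet f f.
Proof.
move=> pf; rewrite /nonlocal_energy.
have pg : poisson m u (xget (cst 0) [set v | poisson m u v]).
  by apply: (@xgetPex _ _ [set v | poisson m u v]); exists f.
move: (xget _ _) pg => g pg.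
by rewrite -/(dirichlet g g) (poisson_dirichlet pg pf) dirichletC -(poisson_dirichlet pf pg).
Qed.

(** Dual variational principle: expand [int |grad f - grad g|^2 >= 0]. *)
Lemma nonlocal_energy_ge m u f g : poisson m u f -> C1 g ->
  2 * sphere_int (fun x => (u x - m) * g x) - dirichlet g g <= nonlocal_energy m u.
Proof.
move=> pf Cg; have [Cf _] := pf; rewrite (nonlocal_energyE pf) -(poissonE pf Cg).
have := sphere_int_grad_gap Cf Cg.
have : 0 <= sphere_int (grad_gap f g) by apply: sphere_int_ge0 => x; exact: dot_ge0.
move: (sphere_int _) (dirichlet f f) (dirichlet f g) (dirichlet g g) => A B C D.
lra.
Qed.

(** A continuous nonnegative function with zero integral vanishes; this is used
    once in the height and once in the angle. *)
Lemma grad_gap_eq0 f g s t : C1 f -> C1 g -> sphere_int (grad_gap f g) = 0 ->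
  -1 < s < 1 -> 0 < t < 2 * pi ->
  sphere_grad f (sphere_point s t) = sphere_grad g (sphere_point s t).
Proof.
move=> Cf Cg; rewrite sphere_intE => E s1 t1.
have cgap := continuous_grad_gap Cf Cg.
have gap0 x : 0 <= grad_gap f g x by exact: dot_ge0.
have zgap0 r : 0 <= zonal (grad_gap f g) r by apply: Rintegral_ge0 => ? _.
have Z0 : zonal (grad_gap f g) s = 0.
  apply: (continuous_Rintegral_eq0 (continuous_zonal cgap) (fun r _ => zgap0 r) E).
  by rewrite in_itv.
have G0 : grad_gap f g (sphere_point s t) = 0.
  apply: (continuous_Rintegral_eq0 (continuous_on_sphere_point (z := s) cgap)
    (fun r _ => gap0 _) Z0).
  by rewrite in_itv.
by apply/eqP; rewrite -subr_eq0; apply/eqP/dot_eq0/G0.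
Qed.

(** The gradient of [v] is that of a solution depending on the height alone,
    which is orthogonal to the parallels. *)
Lemma poisson_axisymmetric m n (z : n.-tuple R) v s t :
  interfaces z -> mass (pattern z) = m -> poisson m (pattern z) v ->
  -1 < s < 1 -> t \in `[0, 2 * pi] ->
  v (sphere_point s t) = v (sphere_point s 0).
Proof.
move=> iz mz pv s1; rewrite in_itv /= => /andP[t0 t2].
have [V [V' [cV' dV pV]]] := poisson_height iz mz.
have [Cv _] := pv; have [CV _] := pV.
have gap : sphere_int (grad_gap v (fun x => V (height x))) = 0.
  rewrite sphere_int_grad_gap // -(poisson_dirichlet pv pV).
  rewrite (poisson_dirichlet pV pv) dirichletC -(poisson_dirichlet pv pV); ring.
have dv r : 0 < r < 2 * pi -> is_derive r 1 (fun a => v (sphere_point s a)) 0.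
  move=> r2; have := @is_derive_curve R v (fun a => sphere_point s a) _ r (Cv.1 _)
    (fun i => is_derive_sphere_point_angle s r i).
  move=> /is_derive_congr; apply.
  have := grad_gap_eq0 Cv CV gap s1 r2.
  rewrite (sphere_grad_height (dV _)) /sphere_grad /meridian.
  move: (sphere_point s r) => p; move: (grad v p) => G E.
  have -> : G = V' (height p) *: (delta_mx 0 i2 - p 0 i2 *: p) + dot G p *: p.
    by rewrite -E subrK.
  by move: (dot G p) => d; rewrite dot3E !mxE /=; ring.
move: t0; rewrite le_eqVlt => /predU1P[<- //|t0].
have [] := @MVT R (fun a => v (sphere_point s a)) (cst 0) 0 t t0.
- by move=> r; rewrite in_itv /= => /andP[r1 r2]; apply: dv; rewrite r1 (lt_le_trans r2).
- by apply: continuous_subspaceT; apply: continuous_on_sphere_point; exact: C1_continuous.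
- by move=> c _; rewrite mul0r => /eqP; rewrite subr_eq0 => /eqP.
Qed.

End Poisson.

(** * First variation along affine families of interfaces *)

Section FirstVariation.
Variable R : realType.
Implicit Types (s t a b m gamma : R).
Local Notation mu := (@lebesgue_measure R).

Definition affine_family n (z : n.-tuple R) (d : 'I_n -> R) t : n.-tuple R :=
  [tuple tnth z i + t * d i | i < n].

Lemma affine_familyE n (z : n.-tuple R) d t i :
  tnth (affine_family z d t) i = tnth z i + t * d i.
Proof. by rewrite tnth_mktuple. Qed.

Lemma affine_family0 n (z : n.-tuple R) d : affine_family z d 0 = z.
Proof. by apply/eq_from_tnth => i; rewrite affine_familyE mul0r addr0. Qed.

Lemma is_derive_affine (a b t : R) : is_derive t 1 (fun s : R => a + s * b) b.
Proof.
apply: (is_derive_congr (is_deriveD (is_derive_cst a t (1 : R))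
  (is_derive_mulr b (is_derive_id t (1 : R))))).
by rewrite add0r mul1r.
Qed.

(** Iterated derivatives of an affine function are affine, which is all that
    smoothness of the family requires. *)
Lemma derive1n_affine j (a b : R) :
  exists a' b', derive1n j (fun s : R => a + s * b) = (fun s => a' + s * b').
Proof.
elim: j => [|j [a' [b' E]]]; first by exists a, b.
exists b', 0; rewrite derive1nS E; apply/funext => t.
by rewrite derive1E mulr0 addr0 (@derive_val _ _ _ _ _ _ _ (is_derive_affine a' b' t)).
Qed.

(** Interfaces are constrained by finitely many strict inequalities between
    continuous functions of the parameter. *)
Lemma near_interfaces n (z : n.-tuple R) d : interfaces z ->
  \forall t \near (0 : R), interfaces (affine_family z d t).
Proof.
move=> iz.
have H (i : 'I_n.+1) : \forall t \near (0 : R),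
   nth 0 (-1 :: rcons (affine_family z d t) 1) i < nth 0 (rcons (affine_family z d t) 1) i.
  have := (pathP 0 iz) i; rewrite size_rcons size_tuple => /(_ (ltn_ord i)) zi.
  pose c t k := nth 0 (rcons (affine_family z d t) 1) k.
  have cc k : continuous_at (0 : R) (fun t => c t k).
    case: (ltnP k n) => kn.
      have -> : (fun t => c t k) = (fun t => tnth z (Ordinal kn) + t * d (Ordinal kn)).
        apply/funext => t; rewrite /c nth_rcons size_tuple kn.
        by rewrite -affine_familyE (tnth_nth 0).
      exact: (is_derive_continuous (fun t => is_derive_affine _ _ t)).
    have -> : (fun t => c t k) = cst (if k == n then 1 else 0).
      apply/funext => t; rewrite /c nth_rcons size_tuple ltnNge kn /=.
      by case: ifP.
    exact: cst_continuous.
  have cl : continuous_at (0 : R) (fun t => nth 0 (-1 :: rcons (affine_family z d t) 1) i).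
    case: (i : nat) => [|k] /=; first exact: cst_continuous.
    exact: cc.
  have cd := continuous_atB (cc i) cl.
  have : 0 < c 0 i - nth 0 (-1 :: rcons (affine_family z d 0) 1) i.
    by rewrite /c affine_family0 subr_gt0.
  move/(cvgr_gt _ cd); apply: filterS => t.
  by rewrite subr_gt0.
near=> t.
have Ht : forall i : 'I_n.+1,
    nth 0 (-1 :: rcons (affine_family z d t) 1) i < nth 0 (rcons (affine_family z d t) 1) i.
  by near: t; apply: filter_forall.
apply/(pathP 0) => i; rewrite size_rcons size_tuple => ni.
exact: (Ht (Ordinal ni)).
Unshelve. all: by end_near. Qed.

Lemma affine_family_admissible m n (z : n.-tuple R) d :
  interfaces z -> mass (pattern z) = m -> \sum_(i < n) (-1) ^+ i * d i = 0 ->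
  admissible_family m z (affine_family z d).
Proof.
move=> iz mz d0; split; first exact: affine_family0.
have [e /= e0 He] := (nbhs_ballP _ _).1 (near_interfaces d iz).
exists e; first exact: e0.
move=> t te.
have it : interfaces (affine_family z d t).
  by apply: He; rewrite /ball /= sub0r normrN.
split; [exact: it| |move=> i j].
  rewrite mass_pattern // -mz mass_pattern //; congr (_ + _).
  transitivity (\sum_(i < n) (-1) ^+ i * (1 - tnth z i) - t * \sum_(i < n) (-1) ^+ i * d i);
    last by rewrite d0 mulr0 subr0.
  rewrite mulr_sumr -sumrB.
  by apply: eq_bigr => i _; rewrite affine_familyE; ring.
have -> : (fun s => tnth (affine_family z d s) i) = (fun s => tnth z i + s * d i).
  by apply/funext => s; rewrite affine_familyE.
have [a' [b' ->]] := derive1n_affine j (tnth z i) (d i).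
by have [] := is_derive_affine a' b' t.
Qed.

Lemma energy_pattern gamma m n (z : n.-tuple R) : interfaces z ->
  fine (energy gamma m (pattern z)) =
  2 * pi * (\sum_(i < n) Num.sqrt (1 - tnth z i ^+ 2)) +
  gamma * nonlocal_energy m (pattern z).
Proof.
move=> iz; rewrite /energy total_variation_pattern // -EFinM -EFinD /=.
by congr (_ + _); field.
Qed.

(** The energy of the pattern [w] with its own potential replaced by a fixed [v]
    in the dual variational principle. *)
Definition energy_minorant gamma m n (v : 'rV[R]_3 -> R)
    (w : n.-tuple R) : R :=
  2 * pi * (\sum_(i < n) Num.sqrt (1 - tnth w i ^+ 2)) +
  gamma * (2 * sphere_int (fun x => (pattern w x - m) * v x) - dirichlet v v).

Lemma energy_minorant_le gamma m n (w : n.-tuple R) v : 0 < gamma ->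
  interfaces w -> mass (pattern w) = m -> C1 v ->
  energy_minorant gamma m v w <= fine (energy gamma m (pattern w)).
Proof.
move=> g0 iw mw Cv; rewrite energy_pattern // lerD2l ler_pM2l //.
have [V [V' [_ _ pV]]] := poisson_height iw mw.
exact: nonlocal_energy_ge pV Cv.
Qed.

Lemma energy_minorant_eq gamma m n (z : n.-tuple R) v :
  interfaces z -> poisson m (pattern z) v ->
  energy_minorant gamma m v z = fine (energy gamma m (pattern z)).
Proof.
move=> iz pv; have [Cv _] := pv.
rewrite energy_pattern // /energy_minorant (nonlocal_energyE pv) -(poissonE pv Cv).
by ring.
Qed.

(** Both terms are explicit in the heights: the charge pairs with [v] through
    primitives of its zonal integral evaluated at the interfaces. *)
Lemma is_derive_energy_minorant gamma m n (z : n.-tuple R) v d :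
  interfaces z -> C1 v ->
  is_derive (0 : R) 1 (fun t => energy_minorant gamma m v (affine_family z d t))
    (- 2 * pi * \sum_(i < n) d i *
      (tnth z i / Num.sqrt (1 - tnth z i ^+ 2) +
       4 * gamma * (-1) ^+ i * ((2 * pi)^-1 * zonal v (tnth z i)))).
Proof.
move=> iz Cv; have cv := C1_continuous Cv.
have cH := continuous_zonal cv.
have [P dP] := continuous_primitive cH.
have p0 : (pi : R) != 0 by rewrite gt_eqF // pi_gt0.
pose I := \int[mu]_(s in `[(-1)%R, 1%R]) zonal v s.
pose L t := 2 * pi * (\sum_(i < n) Num.sqrt (1 - (tnth z i + t * d i) ^+ 2)) +
  gamma * (2 * ((-1 - m) * I + \sum_(i < n) 2 * (-1) ^+ i * (P 1 - P (tnth z i + t * d i)))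
    - dirichlet v v).
have LE : \forall t \near (0 : R), L t = energy_minorant gamma m v (affine_family z d t).
  have := near_interfaces d iz; apply: filterS => t it.
  rewrite /L /energy_minorant sphere_int_pattern_sub //.
  congr (_ * _ + _ * (_ * (_ + _) - _)).
    by apply: eq_bigr => i _; rewrite affine_familyE.
  apply: eq_bigr => i _; rewrite -affine_familyE; congr (_ * _).
  have /andP[_ /ltW zi] := interfaces_itv i it.
  apply/esym/Rintegral_is_derive => //; apply: continuous_subspaceT => //.
  exact: is_derive_continuous dP.
apply: (near_eq_is_derive LE).
have dz i : is_derive (0 : R) 1 (fun t : R => tnth z i + t * d i) (d i) by exact: is_derive_affine.
have dPz i : is_derive (0 : R) 1 (fun t : R => P (tnth z i + t * d i)) (zonal v (tnth z i) * d i).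
  have dPi : is_derive (tnth z i + 0 * d i) 1 P (zonal v (tnth z i)).
    by rewrite mul0r addr0; exact: dP.
  exact: (@is_derive1_comp R P (fun t : R => tnth z i + t * d i) 0 _ _ dPi (dz i)).
have dS i : is_derive (0 : R) 1 (fun t : R => Num.sqrt (1 - (tnth z i + t * d i) ^+ 2))
    ((2 * Num.sqrt (1 - tnth z i ^+ 2))^-1 * (- (2 * tnth z i * d i))).
  have zi := itv_sqr_lt1 (interfaces_itv i iz).
  have dq : is_derive (0 : R) 1 (fun t : R => 1 - (tnth z i + t * d i) ^+ 2) (- (2 * tnth z i * d i)).
    have D := is_deriveB (is_derive_cst (1 : R) (0 : R) (1 : R)) (is_deriveM (dz i) (dz i)).
    apply: (is_derive_congr D); rewrite -![_ *: _]/(_ * _); ring.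
  have ds : is_derive (1 - (tnth z i + 0 * d i) ^+ 2) 1 Num.sqrt (2 * Num.sqrt (1 - tnth z i ^+ 2))^-1.
    by rewrite mul0r addr0; exact: is_derive1_sqrt.
  exact: (@is_derive1_comp R Num.sqrt (fun t : R => 1 - (tnth z i + t * d i) ^+ 2) 0 _ _ ds dq).
have D1 := is_derive_mull (2 * pi) (is_derive_sum_fun dS).
have D2 := is_derive_sum_fun (fun i => is_derive_mull (2 * (-1) ^+ i)
  (is_deriveB (is_derive_cst (P 1) (0 : R) (1 : R)) (dPz i))).
have D3 := is_derive_mull gamma (is_deriveB (is_derive_mull 2
  (is_deriveD (is_derive_cst ((-1 - m) * I) (0 : R) (1 : R)) D2))
  (is_derive_cst (dirichlet v v) (0 : R) (1 : R))).
apply: (is_derive_congr (is_deriveD D1 D3)).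
rewrite subr0 add0r !mulr_sumr -big_split /=; apply: eq_bigr => i _.
rewrite sub0r.
have s0 : Num.sqrt (1 - tnth z i ^+ 2) != 0.
  by rewrite gt_eqF // sqrtr_gt0 itv_sqr_lt1 // interfaces_itv.
move: {D1 D2 D3 L LE} (pi : R) p0 (Num.sqrt _) s0 => p p0 r r0.
by field; rewrite p0 r0.
Qed.

(** The energy stays above its minorant, with equality at the initial pattern,
    so criticality passes to the minorant. *)
Lemma first_variation gamma m n (z : n.-tuple R) v (d : 'I_n -> R) :
  0 < gamma -> interfaces z -> mass (pattern z) = m ->
  critical_1d gamma m z -> poisson m (pattern z) v ->
  \sum_(i < n) (-1) ^+ i * d i = 0 ->
  \sum_(i < n) d i * (tnth z i / Num.sqrt (1 - tnth z i ^+ 2) +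
       4 * gamma * (-1) ^+ i * ((2 * pi)^-1 * zonal v (tnth z i))) = 0.
Proof.
move=> g0 iz mz crit pv d0; have [Cv _] := pv.
have adm := affine_family_admissible iz mz d0.
have [_ [e e0 He]] := adm.
set S := \sum_(i < n) _.
pose E t := fine (energy gamma m (pattern (affine_family z d t))).
pose M t := energy_minorant gamma m v (affine_family z d t).
have dE : is_derive (0 : R) 1 E 0 by exact: crit adm.
have dM : is_derive (0 : R) 1 M (- 2 * pi * S) by exact: is_derive_energy_minorant.
have M0 : M 0 = E 0 by rewrite /M /E affine_family0; exact: energy_minorant_eq.
have ME t : `|t| < e -> M t <= E t.
  by move=> /He [it mt _]; exact: energy_minorant_le.
have dD : is_derive (0 : R) 1 (fun t => E t - M t) (0 - (- 2 * pi * S)).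
  exact: is_deriveB dE dM.
clearbody E M S.
have : 0 - (- 2 * pi * S) = 0.
  apply: (@is_derive_local_min R (fun t => E t - M t) _ e e0 dD) => t te.
  by rewrite M0 subrr subr_ge0; exact: ME.
have := pi_gt0 R; move: (pi : R) => p p0 pS.
have /eqP : p * S = 0 by lra.
by rewrite mulf_eq0 gt_eqF //= => /eqP.
Qed.

End FirstVariation.

Theorem proposition4p4 (R : realType) (gamma m : R) (n : nat)
    (z : n.-tuple R) (v : 'rV[R]_3 -> R) :
  0 < gamma -> -1 < m < 1 -> (1 <= n)%N ->
  interfaces z -> mass (pattern z) = m ->
  critical_1d gamma m z ->
  poisson m (pattern z) v ->
  exists lambda : R, forall (k : 'I_n) (x : 'rV[R]_3),
    sphere x -> height x = tnth z k ->
    geodesic_curvature z k + 4 * gamma * v x = lambda.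
Proof.
move=> g0 _ n0 iz mz crit pv.
pose B i := tnth z i / Num.sqrt (1 - tnth z i ^+ 2) +
       4 * gamma * (-1) ^+ i * ((2 * pi)^-1 * zonal v (tnth z i)).
pose o : 'I_n := Ordinal n0.
exists (B o) => k x sx hx.
have zk := interfaces_itv k iz.
have vx : (2 * pi)^-1 * zonal v (tnth z k) = v x.
  have ax t : t \in `[0, 2 * pi] -> v (sphere_point (tnth z k) t) = v (sphere_point (tnth z k) 0).
    exact: (poisson_axisymmetric iz mz pv zk).
  have [t tI ->] : exists2 t, t \in `[0, 2 * pi] & x = sphere_point (tnth z k) t.
    by rewrite -hx; apply: sphere_point_surj => //; rewrite hx.
  rewrite ax //; have -> : zonal v (tnth z k) = zonal (fun=> v (sphere_point (tnth z k) 0)) (tnth z k).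
    by apply: eq_Rintegral => r; rewrite inE => rI; exact: ax.
  rewrite zonal_cst mulKf // mulf_neq0 ?pnatr_eq0 // gt_eqF // pi_gt0 //.
have sgn (j : nat) : (-1) ^+ j * (-1) ^+ j = 1 :> R by rewrite -expr2 sqrr_sign.
(* Mass-preserving exchange between the interface of index k and the first one;
   it vanishes when the two coincide. *)
pose d (i : 'I_n) : R := (-1) ^+ k * (i == k)%:R - (i == o)%:R.
have sumd (F : 'I_n -> R) : \sum_(i < n) d i * F i = (-1) ^+ k * F k - F o.
  under eq_bigr do rewrite mulrBl.
  rewrite sumrB; congr (_ - _).
    rewrite (bigD1 k) //= eqxx mulr1 big1 ?addr0 // => i /negPf ->.
    by rewrite mulr0 mul0r.
  rewrite (bigD1 o) // eqxx mul1r big1 => [|i /negPf ->]; last by rewrite mul0r.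
  exact: addr0.
have d0 : \sum_(i < n) (-1) ^+ i * d i = 0.
  under eq_bigr do rewrite mulrC.
  by rewrite (sumd (fun i => (-1) ^+ i)) sgn expr0 subrr.
have := first_variation g0 iz mz crit pv d0.
rewrite (sumd B) => /subr0_eq <-.
rewrite /B /geodesic_curvature vx -[k.+2]addn2 exprD sqrrN expr1n mulr1.
move: (sgn k); move: ((-1) ^+ k) => e ee.
transitivity (e * (tnth z k / Num.sqrt (1 - tnth z k ^+ 2)) + 4 * gamma * (e * e) * v x).
  by rewrite ee; ring.
by ring.
Qed.
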